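(* Consider a discounted constrained MDP with finite state space $\mathcal{S}$, finite action space $\mathcal{A}$, transition matrices $P_a$ ($a\in\mathcal{A}$), discount $\gamma\in(0,1)$, initial distribution $q$, reward vectors $r_a\in\mathbb{R}^{|\mathcal{S}|}$, constraint cost vectors $g^i_a\in\mathbb{R}^{|\mathcal{S}|}$ and thresholds $h^i$, $i\in[I]$. Assume Slater's condition: there exist $\tilde\lambda\in\Delta$ and $\psi>0$ with $\sum_a\tilde\lambda_a^Tg^i_a\ge h^i+\psi$ for all $i\in[I]$ and $\sum_a(I-\gamma P_a^T)\tilde\lambda_a=(1-\gamma)q$. Let $\mathcal{U}=\{\mu\in\mathbb{R}^I_{\ge0}:\|\mu\|_1\le 2/\psi\}$ and $\mathcal{V}=\{v\in\mathbb{R}^{|\mathcal{S}|}:\|v\|_\infty\le\frac{1}{1-\gamma}+\frac{2}{(1-\gamma)\psi}\}$, fix $\rho>0$, and consider the projected saddle flow dynamics \[ \dot v=\Pi_{\mathcal{V}}\Big[v,\ \textstyle\sum_a(I-\gamma P_a^T)\lambda_a-(1-\gamma)q-\tfrac1\rho(v-\hat v)\Big],\quad \dot{\hat v}=\Pi_{\mathcal{V}}\Big[\hat v,\tfrac1\rho(v-\hat v)\Big], \] \[ \dot\mu=\Pi_{\mathcal{U}}\Big[\mu,\ \big(h^i-\textstyle\sum_a\lambda_a^Tg^i_a\big)_{i\in[I]}-\tfrac1\rho(\mu-\hat\mu)\Big],\quad \dot{\hat\mu}=\Pi_{\mathcal{U}}\Big[\hat\mu,\tfrac1\rho(\mu-\hat\mu)\Big],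 \] \[ \dot\lambda=\Pi_{\Delta}\Big[\lambda,\ \big(r_a-(I-\gamma P_a)v+\textstyle\sum_i\mu_ig^i_a\big)_{a\in\mathcal{A}}-\tfrac1\rho(\lambda-\hat\lambda)\Big],\quad \dot{\hat\lambda}=\Pi_{\Delta}\Big[\hat\lambda,\tfrac1\rho(\lambda-\hat\lambda)\Big], \] with initialization $\lambda(0),\hat\lambda(0)\in\Delta$, $\mu(0),\hat\mu(0)\in\mathcal{U}$, $v(0),\hat v(0)\in\mathcal{V}$. Then these dynamics asymptotically converge to some saddle point $(\lambda^*,\mu^*,v^* )$ of the Lagrangian \[ L(\lambda,\mu,v)=\textstyle\sum_a\lambda_a^Tr_a+\sum_i\mu_i\big(\sum_a\lambda_a^Tg^i_a-h^i\big)+(1-\gamma)\langle q,v\rangle-\sum_a\lambda_a^T(I-\gamma P_a)v, \] while $\lambda(t)\in\Delta$ and $\mu(t)\in\mathcal{U}$ for all $t$.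
   Context: $\Delta$ is the probability simplex of functions $\lambda:\mathcal{S}\times\mathcal{A}\to[0,1]$ with $\sum_{s,a}\lambda(s,a)=1$; $\lambda_a=(\lambda(s,a))_{s\in\mathcal{S}}\in\mathbb{R}^{|\mathcal{S}|}$, $r_a=(r(s,a))_s$, $g^i_a=(g^i(s,a))_s$ with $r:\mathcal{S}\times\mathcal{A}\to[0,1]$, $g^i:\mathcal{S}\times\mathcal{A}\to[-1,1]$, and $P_a\in\mathbb{R}^{|\mathcal{S}|\times|\mathcal{S}|}$ has entries $P_a[s,s']=P(s'|s,a)$. The constrained RL problem in occupancy-measure form is the linear program $\max_{\lambda\in\Delta}\sum_a\lambda_a^Tr_a$ s.t. $\sum_a\lambda_a^Tg^i_a\ge h^i$ ($i\in[I]$) and $\sum_a(I-\gamma P_a^T)\lambda_a=(1-\gamma)q$; $L$ is its Lagrangian with multipliers $\mu\ge0$ and $v$, maximized over $\lambda$ and minimized over $(\mu,v)$. For a closed convex set $\mathcal{K}$, $\Psi_{\mathcal{K}}$ is Euclidean projection onto $\mathcal{K}$ and, for $x\in\mathcal{K}$, $\Pi_{\mathcal{K}}[x,v]=\lim_{\delta\to0^+}(\Psi_{\mathcal{K}}[x+\delta v]-x)/\delta$. *)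

(* Defs.v *)
From HB Require Import structures.
From mathcomp Require Import all_boot all_order all_algebra.
From mathcomp Require Import all_classical all_reals all_analysis.
Set Implicit Arguments. Unset Strict Implicit. Unset Printing Implicit Defensive.
Import Order.TTheory GRing.Theory Num.Theory.
Import numFieldNormedType.Exports.
Local Open Scope classical_set_scope.
Local Open Scope ring_scope.

Section CMDP.
Variable R : realType.

Definition sqdist (m n : nat) (x y : 'M[R]_(m, n)) : R :=
  \sum_(i < m) \sum_(j < n) (x i j - y i j) ^+ 2.

(* Euclidean projection Psi_K onto a set K (a closed convex nonempty set in
   our uses, so that the minimiser exists and is unique). *)
Definition Psi (m n : nat) (K : set 'M[R]_(m, n)) (x : 'M[R]_(m, n)) : 'M[R]_(m, n) :=
  get [set y | K y /\ forall z, K z -> sqdist x y <= sqdist x z].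

Definition Pi (m n : nat) (K : set 'M[R]_(m, n)) (x v : 'M[R]_(m, n)) : 'M[R]_(m, n) :=
  lim ((fun d : R => d^-1 *: (Psi K (x + d *: v) - x)) @ 0^'+).

Definition abs_cont (a b : R) (f : R -> R) : Prop :=
  forall e : R, 0 < e -> exists2 d : R, 0 < d &
    forall (N : nat) (x y : 'I_N -> R),
      (forall k, [/\ a <= x k, x k < y k & y k <= b]) ->
      (forall k l, k != l -> y k <= x l \/ y l <= x k) ->
      \sum_(k < N) (y k - x k) < d ->
      \sum_(k < N) `|f (y k) - f (x k)| < e.

(* x : [0, oo) -> 'M_(m,n) is a (Caratheodory) solution of the projected
   dynamics  xdot = Pi_K[x, F t]  : every coordinate is absolutely continuous
   on every [0, T], and for almost every t >= 0, x t lies in K (the domain of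
   Pi_K[., .]) and x is differentiable at t with derivative Pi_K[x t, F t]. *)
Definition proj_solution (m n : nat) (K : set 'M[R]_(m, n))
    (x F : R -> 'M[R]_(m, n)) : Prop :=
  (forall (i : 'I_m) (j : 'I_n) (T : R), 0 < T -> abs_cont 0 T (fun t => x t i j)) /\
  {ae (@lebesgue_measure R), forall t : R, 0 <= t ->
      K (x t) /\ is_derive t 1 x (Pi K (x t) (F t))}.

Variables (nS nA nI : nat).

Definition Simplex : set 'M[R]_(nS, nA) :=
  [set l | (forall s a, 0 <= l s a) /\ \sum_(s < nS) \sum_(a < nA) l s a = 1].

(* sum_a (I - gamma P_a^T) lambda_a, as a row vector indexed by states;
   P a s s' = P(s' | s, a). *)
Definition flow (gamma : R) (P : 'I_nA -> 'M[R]_nS) (l : 'M[R]_(nS, nA)) : 'rV[R]_nS :=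
  \row_s (\sum_(a < nA) l s a
          - gamma * \sum_(a < nA) \sum_(s' < nS) P a s' s * l s' a).

Definition bellman (gamma : R) (P : 'I_nA -> 'M[R]_nS) (v : 'rV[R]_nS)
    (s : 'I_nS) (a : 'I_nA) : R :=
  v 0 s - gamma * \sum_(s' < nS) P a s s' * v 0 s'.

Definition inner (l g : 'M[R]_(nS, nA)) : R :=
  \sum_(s < nS) \sum_(a < nA) l s a * g s a.

Definition Lagrangian (gamma : R) (P : 'I_nA -> 'M[R]_nS) (q : 'rV[R]_nS)
    (r : 'M[R]_(nS, nA)) (g : 'I_nI -> 'M[R]_(nS, nA)) (h : 'rV[R]_nI)
    (l : 'M[R]_(nS, nA)) (mu : 'rV[R]_nI) (v : 'rV[R]_nS) : R :=
  inner l r + \sum_(i < nI) mu 0 i * (inner l (g i) - h 0 i)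
  + (1 - gamma) * \sum_(s < nS) q 0 s * v 0 s
  - \sum_(s < nS) \sum_(a < nA) l s a * bellman gamma P v s a.

Definition saddle_point (L : 'M[R]_(nS, nA) -> 'rV[R]_nI -> 'rV[R]_nS -> R)
    (l : 'M[R]_(nS, nA)) (mu : 'rV[R]_nI) (v : 'rV[R]_nS) : Prop :=
  Simplex l /\ (forall i, 0 <= mu 0 i) /\
  (forall l', Simplex l' -> L l' mu v <= L l mu v) /\
  (forall (mu' : 'rV[R]_nI) (v' : 'rV[R]_nS), (forall i, 0 <= mu' 0 i) -> L l mu v <= L l mu' v').

Definition Uset (psi : R) : set 'rV[R]_nI :=
  [set mu | (forall i, 0 <= mu 0 i) /\ \sum_(i < nI) `|mu 0 i| <= 2 / psi].

Definition Vset (gamma psi : R) : set 'rV[R]_nS :=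
  [set v | forall s, `|v 0 s| <= 1 / (1 - gamma) + 2 / ((1 - gamma) * psi)].

End CMDP.

(* Main.v *)
(** The six projected equations are one flow [z' = Pi_K[z, F z - (z - zh) / rho]],
    [zh' = Pi_K[zh, (z - zh) / rho]] on the compact convex set [K = Simplex * U * V], where
    [F] is affine and skew: [<z - w, F z> = <z - w, F w>].  Hence for a solution [w] of the
    variational inequality [<w - y, F y> >= 0] on [K] (a saddle point of the Lagrangian
    restricted to [K]; one exists by averaging projected gradient steps),
    [|z - w|^2 + |zh - w|^2] decreases at rate at least [2 |z - zh|^2 / rho].  So [z - zh]
    vanishes, every cluster point of [z] solves the variational inequality, and the Lyapunov
    function at a cluster point forces convergence to it.  A solution [z] is merely absolutely
    continuous, so these decrease estimates rest on the mean value inequality [abs_cont_le].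
    Finally, the sizes of [U] and [V] make a saddle point over [K] a saddle point of the
    unrestricted Lagrangian. *)
Require Import Defs.
From HB Require Import structures.
From mathcomp Require Import all_boot all_order all_algebra.
From mathcomp Require Import all_classical all_reals all_analysis.
From mathcomp Require Import ring lra.
Import Order.TTheory GRing.Theory Num.Theory.
Import numFieldNormedType.Exports.
Local Open Scope classical_set_scope.
Local Open Scope ring_scope.

Set Implicit Arguments.
Unset Strict Implicit.
Unset Printing Implicit Defensive.

(** Skewness makes [F] monotone with equality only: without the proximal terms the flow may
    circulate around a saddle point, and with them the dissipation controls [z - zh] but says
    nothing about [F]. That cluster points solve the variational inequality must therefore be
    extracted separately, by following [|z - w|^2 + |zh - w|^2] for arbitrary [w] in [K], not only
    for solutions. Skewness also lets the field be evaluated at the fixed [w], so that every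
    estimate is linear in the trajectory. The projected field jumps at the boundary of [K], so a
    direct argument takes the place of an invariance principle. Of [Pi] only an angle inequality and
    a norm bound are retained; both add over blocks, so [Pi] of the product set is never computed.
    The constants: Slater's condition forces [|mu|_1 <= 1 / psi], half of what [U] allows, so its
    upper face is inactive; the radius [B] of [V] satisfies [(1 - gamma) * B = 1 + 2 / psi], and
    twice this exceeds a reward gap of at most 1 plus a cost gap of at most [4 / psi]. *)

Lemma cvgr_le_lim (R : realType) (T : Type) (F : set_system T) (FF : ProperFilter F)
    (f : T -> R) l c : f @ F --> l -> (\forall t \near F, f t <= c) -> l <= c.
Proof.
by move=> fl fc; rewrite -(cvg_lim _ fl) //; apply: limr_le => //; apply/cvg_ex; exists l.
Qed.

Lemma inner_sqdist (R : realType) m n (x y : 'M[R]_(m, n)) :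
  sqdist x y = inner (x - y) (x - y).
Proof. by do 2 (apply: eq_bigr => ? _); rewrite !mxE expr2. Qed.

(** * Matrices as a Euclidean space: inner product and coordinatewise compactness *)

Section Inner.
Variables (R : realType) (m n : nat).
Implicit Types x y z : 'M[R]_(m, n).

Lemma innerC x y : inner x y = inner y x.
Proof. by do 2 (apply: eq_bigr => ? _); rewrite mulrC. Qed.

Lemma innerDl x y z : inner (x + y) z = inner x z + inner y z.
Proof.
rewrite /inner -big_split /=; apply: eq_bigr => i _.
by rewrite -big_split /=; apply: eq_bigr => j _; rewrite mxE mulrDl.
Qed.

Lemma innerZl a x y : inner (a *: x) y = a * inner x y.
Proof.
rewrite /inner mulr_sumr; apply: eq_bigr => i _.
by rewrite mulr_sumr; apply: eq_bigr => j _; rewrite mxE mulrA.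
Qed.

Lemma inner0l x : inner 0 x = 0.
Proof. by rewrite -(scale0r 0) innerZl mul0r. Qed.

Lemma innerDr x y z : inner z (x + y) = inner z x + inner z y.
Proof. by rewrite ![inner z _]innerC innerDl. Qed.

Lemma innerZr a x y : inner x (a *: y) = a * inner x y.
Proof. by rewrite ![inner x _]innerC innerZl. Qed.

Lemma innerNl x y : inner (- x) y = - inner x y.
Proof. by rewrite -scaleN1r innerZl mulN1r. Qed.

Lemma innerNr x y : inner x (- y) = - inner x y.
Proof. by rewrite innerC innerNl innerC. Qed.

Definition innerE := (innerDl, innerDr, innerNl, innerNr, innerZl, innerZr).

Lemma inner_subZ t x y : inner (x - t *: y) (x - t *: y) =
  inner x x - 2 * t * inner x y + t ^+ 2 * inner y y.
Proof. by rewrite !innerE (innerC y x); ring. Qed.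

Lemma inner_ge0 x : 0 <= inner x x.
Proof. by apply: sumr_ge0 => i _; apply: sumr_ge0 => j _; rewrite -expr2 sqr_ge0. Qed.

Lemma inner_coord_le x i j : x i j ^+ 2 <= inner x x.
Proof.
rewrite /inner (bigD1 i) //= (bigD1 j) //= expr2 -addrA lerDl addr_ge0 //.
  by apply: sumr_ge0 => k _; rewrite -expr2 sqr_ge0.
by apply: sumr_ge0 => k _; apply: sumr_ge0 => l _; rewrite -expr2 sqr_ge0.
Qed.

Lemma cvg_inner (T : Type) (F : set_system T) (FF : Filter F)
    (f g : T -> 'M[R]_(m, n)) a b :
  f @ F --> a -> g @ F --> b -> inner (f t) (g t) @[t --> F] --> inner a b.
Proof.
move=> fa gb.
apply: cvg_big => [|i _]; first exact: add_continuous.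
apply: cvg_big => [|j _]; first exact: add_continuous.
apply: cvgM.
  by apply: (cvg_comp f (fun M : 'M[R]_(m, n) => M i j) fa); exact: coord_continuous.
by apply: (cvg_comp g (fun M : 'M[R]_(m, n) => M i j) gb); exact: coord_continuous.
Qed.

Lemma cvg_mx_coord (T : Type) (F : set_system T) (FF : Filter F)
    (f : T -> 'M[R]_(m, n)) (a : 'M[R]_(m, n)) :
  (forall i j, f t i j @[t --> F] --> a i j) -> f @ F --> a.
Proof.
move=> fa; apply/cvgrPdist_le => e e0; near=> t.
rewrite /Num.Def.normr/= mx_normrE (bigmax_le _ (ltW e0))//= => i _; rewrite !mxE.
move: i; near: t; apply: filter_forall => i.
exact: ((cvgrPdist_le _ _).1 (fa i.1 i.2)).
Unshelve. all: by end_near. Qed.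

Lemma closed_bounded_coord_compact (K : set 'M[R]_(m, n)) B : closed K ->
  (forall x, K x -> forall i j, `|x i j| <= B) -> compact K.
Proof.
move=> clK KB.
pose C := [set v : 'rV[R]_(m * n) | forall i, v ord0 i \in `[- B, B]].
have cC : compact C.
  apply: (@rV_compact _ _ (fun=> `[- B, B]%classic)) => i; exact: segment_compact.
have cv : compact [set vec_mx v | v in C].
  apply: continuous_compact => //; apply: continuous_subspaceT => v.
  apply: (@cvg_mx_coord _ (nbhs v) _ vec_mx (vec_mx v)) => i j.
  under eq_fun do rewrite mxE; rewrite mxE; exact: coord_continuous.
apply: (subclosed_compact clK cv) => x Kx; exists (mxvec x); last by rewrite mxvecK.
move=> k; case/mxvec_indexP: k => i j.
by rewrite in_itv /= -ler_norml (_ : mxvec x ord0 _ = x i j) ?KB // -(mxvecE x i j).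
Qed.

Definition convex_mx (K : set 'M[R]_(m, n)) :=
  forall x y t, K x -> K y -> 0 <= t <= 1 -> K (x + t *: (y - x)).

(** * Euclidean projection onto a compact convex set, and existence and properties of [Pi] *)

Section Projection.
Variable K : set 'M[R]_(m, n).
Hypotheses (cK : compact K) (K0 : K !=set0) (vK : convex_mx K).

Lemma Psi_min x : K (Psi K x) /\ forall z, K z -> sqdist x (Psi K x) <= sqdist x z.
Proof.
have [c cKc cmin] : exists2 c, c \in K & forall t, t \in K -> sqdist x c <= sqdist x t.
  apply: compact_EVT_min => //; apply: continuous_subspaceT => y.
  have -> : sqdist x = fun y => inner (x - y) (x - y) by apply/funext => ?; exact: inner_sqdist.
  have xB : x - z @[z --> y] --> x - y by apply: (@cvgB _ _ _ (nbhs y)); [exact: cvg_cst|exact: cvg_id].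
  exact: (@cvg_inner _ (nbhs y)).
rewrite /Psi; case: xgetP => [y -> //|/(_ c)[]].
by split; [exact: set_mem|move=> z Kz; apply: cmin; exact: mem_set].
Qed.

Lemma Psi_in x : K (Psi K x).
Proof. by have [] := Psi_min x. Qed.

Lemma Psi_vi x z : K z -> inner (x - Psi K x) (z - Psi K x) <= 0.
Proof.
move=> Kz; have [Kp pmin] := Psi_min x; set p := Psi K x in Kp pmin *.
rewrite leNgt; apply/negP => c0.
set c := inner _ _ in c0; pose D := inner (z - p) (z - p).
have D0 : 0 <= D := inner_ge0 _.
have cD : 0 < c + D by lra.
(* This choice keeps [t] in []0, 1]] and gives [t * D < c], so moving from [p] towards [z] changes
   the squared distance to [x] by [- 2 * t * c + t ^+ 2 * D < 0]. *)
pose t := c / (c + D).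
have t0 : 0 < t by rewrite divr_gt0.
have t1 : t <= 1 by rewrite ler_pdivrMr // mul1r; lra.
have /pmin : K (p + t *: (z - p)) by apply: vK; rewrite // (ltW t0) t1.
rewrite !inner_sqdist opprD addrA inner_subZ -/c -/D.
have tcD : t * (c + D) = c by rewrite mulfVK // gt_eqF.
have : t * D < c by rewrite -tcD ltr_pM2l //; lra.
by move=> h1; rewrite leNgt => /negP; apply; nra.
Qed.

Section TangentProjection.
Variables (x v : 'M[R]_(m, n)).
Hypothesis Kx : K x.

Let p d := d^-1 *: (Psi K (x + d *: v) - x).

Let pK d : d != 0 -> Psi K (x + d *: v) = x + d *: p d.
Proof. by move=> d0; rewrite /p scalerA divff // scale1r subrKC. Qed.

Let p_vi d y : 0 < d -> K y -> inner (v - p d) (y - x - d *: p d) <= 0.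
Proof.
move=> d0 Ky; have := Psi_vi (x + d *: v) Ky.
rewrite pK ?gt_eqF // opprD addrACA subrr add0r -scalerBr innerZl pmulr_rle0 //.
by rewrite addrA.
Qed.

(* The quotient at a larger step is feasible for the smaller one, by convexity. *)
Let p_mono d d' : 0 < d' -> d' <= d -> inner (v - p d') (p d - p d') <= 0.
Proof.
move=> d'0 d'd; have d0 : 0 < d by exact: lt_le_trans d'd.
have Ky : K (x + d' *: p d).
  have -> : x + d' *: p d = x + (d' / d) *: (Psi K (x + d *: v) - x) by rewrite /p scalerA.
  apply: vK => //; first exact: Psi_in.
  by rewrite ler_pdivrMr // mul1r d'd andbT divr_ge0 // ltW.
by have := p_vi d'0 Ky; rewrite (addrC x) addrK -scalerBr innerZr pmulr_rle0.
Qed.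

Let N d := inner (v - p d) (v - p d).

(** By [p_mono] the angle at [p d'] between [v] and [p d] is not acute, so the squared side opposite
    to it, [N d], is at least the sum of the other two squares. *)
Let p_cauchy d d' : 0 < d' -> d' <= d -> inner (p d - p d') (p d - p d') <= N d - N d'.
Proof.
move=> d'0 d'd; have := p_mono d'0 d'd; rewrite /N.
move: (p d) (p d') => a' b'.
have -> : v - a' = (v - b') - (a' - b') by rewrite opprB addrA subrK.
move: (v - b') (a' - b') => a b; rewrite !innerE (innerC b a); lra.
Qed.

(** By [p_cauchy], [N] is nondecreasing in [d] and its oscillation near 0 controls that of [p]; as
    [N] is bounded below, the quotients are Cauchy. Hence the [lim] in [Pi] is a true limit and not
    a default value. *)
Let p_cvg : cvg (p d @[d --> 0^'+]).
Proof.
pose A := [set N d | d in [set d : R | 0 < d]].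
have infA : has_inf A.
  split; first by exists (N 1); exists 1 => //=.
  by exists 0 => _ [d _ <-]; exact: inner_ge0.
apply/cauchy_cvgP; apply: cauchy_exP => e e0.
have [_ [d0 /= d00 <-] hd0] : exists2 a, A a & a < inf A + e ^+ 2.
  by apply: inf_adherent; rewrite // exprn_gt0.
exists (p d0); near=> d.
have d_0 : 0 < d by near: d; exact: nbhs_right_gt.
have dd0 : d <= d0 by near: d; exact: nbhs_right_le.
split=> // i j; rewrite /ball /=.
have Nd : inf A <= N d by apply: ge_inf; [case: infA|exists d].
have := p_cauchy d_0 dd0; have := inner_coord_le (p d0 - p d) i j.
rewrite mxE [X in _ + X]mxE => h1 h2.
have h3 : (p d0 i j - p d i j) ^+ 2 < e ^+ 2.
  apply: le_lt_trans (le_trans h1 h2) _.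
  by rewrite ltrBlDr (lt_le_trans hd0) // addrC lerD2l.
by rewrite -(ltr_pXn2r (n := 2)) ?nnegrE ?normr_ge0 ?(ltW e0) // real_normK ?num_real.
Unshelve. all: by end_near. Qed.

Let pPi : p d @[d --> 0^'+] --> Pi K x v.
Proof. exact: p_cvg. Qed.

(** The limit of [p_vi] as [d] tends to 0: [v - Pi K x v] lies in the normal cone of [K] at [x]. *)
Lemma Pi_vi y : K y -> inner (x - y) (Pi K x v) <= inner (x - y) v.
Proof.
move=> Ky.
suff : inner (v - Pi K x v) (y - x) <= 0.
  by rewrite -(opprB x y) innerC !innerE; lra.
have h : inner (v - p d) (y - x - d *: p d) @[d --> 0^'+] -->
    inner (v - Pi K x v) (y - x - 0 *: Pi K x v).
  apply: cvg_inner; first by apply: cvgB => //; exact: cvg_cst.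
  apply: cvgB; first exact: cvg_cst.
  by apply: cvgZ => //; apply: cvg_at_right_filter; exact: cvg_id.
rewrite scale0r subr0 in h.
apply: (cvgr_le_lim _ h); near=> d; apply: p_vi => //; near: d; exact: nbhs_right_gt.
Unshelve. all: by end_near. Qed.

(** Testing [p_vi] at [y = x] gives [|p d|^2 <= <v, p d>], and expanding [|v - p d|^2 >= 0] turns
    this into [|p d|^2 <= |v|^2]. This bound yields the Lipschitz estimates for trajectories. *)
Lemma Pi_norm_le : inner (Pi K x v) (Pi K x v) <= inner v v.
Proof.
have h : inner (p d) (p d) @[d --> 0^'+] --> inner (Pi K x v) (Pi K x v).
  exact: cvg_inner.
apply: (cvgr_le_lim _ h); near=> d.
have d0 : 0 < d by near: d; exact: nbhs_right_gt.
have := p_vi d0 Kx; rewrite subrr sub0r innerNr innerZr oppr_le0 pmulr_rge0 //.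
have := inner_ge0 (v - p d); move: (p d) => a; rewrite !innerE (innerC a v); lra.
Unshelve. all: by end_near. Qed.

End TangentProjection.
End Projection.
End Inner.

(** * A mean value inequality for absolutely continuous functions *)

Section AbsolutelyContinuous.
Variable R : realType.
Implicit Types (f : R -> R) (a b c t : R).

Lemma abs_cont_sub a b a' b' f : a <= a' -> b' <= b ->
  abs_cont a b f -> abs_cont a' b' f.
Proof.
move=> aa' bb' fab e e0; have [d d0 fd] := fab e e0; exists d => // N x y xy.
by apply: fd => k; have [h1 h2 h3] := xy k; split => //; [exact: le_trans h1|exact: le_trans bb'].
Qed.

Lemma abs_contN a b f : abs_cont a b f -> abs_cont a b (fun t => - f t).
Proof.
move=> fab e e0; have [d d0 fd] := fab e e0; exists d => // N x y xy xx xd.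
by under eq_bigr do rewrite -opprD normrN; exact: fd.
Qed.

Lemma lip_abs_cont a b f L :
  (forall t s, a <= t -> t <= s -> s <= b -> `|f s - f t| <= L * (s - t)) -> abs_cont a b f.
Proof.
move=> fL e e0; have L1 : 0 < `|L| + 1 by rewrite ltr_wpDl.
exists (e / (`|L| + 1)); first exact: divr_gt0.
move=> N x y xy _; rewrite ltr_pdivlMr // => h.
apply: le_lt_trans h; rewrite mulr_suml; apply: ler_sum => k _.
have [h1 h2 h3] := xy k; apply: le_trans (fL _ _ h1 (ltW h2) h3) _.
by rewrite mulrC ler_wpM2l ?subr_ge0 ?(ltW h2) // (le_trans (ler_norm L)) // lerDl.
Qed.

(** Absolute continuity in the form in which the real induction delivers its intervals: a list, the
    latest interval first. *)
Lemma abs_cont_seq a b f e : abs_cont a b f -> 0 < e ->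
  exists2 d, 0 < d & forall s : seq (R * R),
    all (fun p => [&& a <= p.1, p.1 < p.2 & p.2 <= b]) s ->
    pairwise (fun p q => q.2 <= p.1) s ->
    \sum_(p <- s) (p.2 - p.1) < d -> \sum_(p <- s) `|f p.2 - f p.1| < e.
Proof.
move=> fab e0; have [d d0 fd] := fab e e0; exists d => // s /allP sab /(pairwiseP (0, 0)) ps.
rewrite !(big_nth (0, 0)) !big_mkord => sd.
apply: (fd _ (fun k => (nth (0, 0) s k).1) (fun k => (nth (0, 0) s k).2)) sd => [k|k l].
  by have /sab /and3P[] : nth (0, 0) s k \in s by rewrite mem_nth.
rewrite -val_eqE neq_ltn => /orP[kl|lk]; [right|left].
- by apply: ps; rewrite ?inE.
- by apply: ps; rewrite ?inE.
Qed.

(* Real induction on [t]: advance through [U] at the cost of the (small) variation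
   over the intervals used, and elsewhere with slope at most [c]. *)
Lemma real_induction_slope (U : set R) a b c f : a < b -> open U ->
  (forall t, a <= t <= b -> ~ U t -> exists2 d, 0 < d &
     forall u, `|u - t| < d -> (t <= u -> f u - f t <= c * (u - t)) /\
                               (u <= t -> f t - f u <= c * (t - u))) ->
  exists s : seq (R * R), [/\ all (fun p => [&& a <= p.1, p.1 < p.2 & p.2 <= b]) s,
    pairwise (fun p q => q.2 <= p.1) s,
    ((\sum_(p <- s) (p.2 - p.1))%:E <= lebesgue_measure (U `&` `[a, b[))%E &
    f b - f a <= c * (b - a) + `|c| * \sum_(p <- s) (p.2 - p.1)
      + \sum_(p <- s) `|f p.2 - f p.1|].
Proof.
move=> ab oU fU.
(* The interval [[a, t[] is half open so that appending [[t, t'[] is a disjoint union and the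
   measures add. *)
pose cov t s := [/\ all (fun p => [&& a <= p.1, p.1 < p.2 & p.2 <= t]) s,
    pairwise (fun p q => q.2 <= p.1) s,
    ((\sum_(p <- s) (p.2 - p.1))%:E <= lebesgue_measure (U `&` `[a, t[))%E &
    f t - f a <= c * (t - a) + `|c| * \sum_(p <- s) (p.2 - p.1)
      + \sum_(p <- s) `|f p.2 - f p.1|].
pose S := [set t | a <= t <= b /\ exists s : seq (R * R), cov t s].
suff : S b by case.
have Sa : S a.
  split; first by rewrite lexx ltW.
  by exists [::]; split => //; rewrite !big_nil ?measure_ge0 // !subrr !mulr0 !addr0.
have mU t : measurable (U `&` `[a, t[) by apply: measurableI => //; exact: measurable_realfun.open_measurable.
have step t t' : S t -> t < t' -> t' <= b ->
    (`[t, t'] `<=` U \/ f t' - f t <= c * (t' - t)) -> S t'.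
  move=> [/andP[at_ tb] [s [s1 s2 s3 s4]]] tt' t'b h.
  split; first by rewrite t'b (le_trans at_) ?ltW.
  have s1' : all (fun p => [&& a <= p.1, p.1 < p.2 & p.2 <= t']) s.
    apply: sub_all s1 => p /and3P[-> -> /le_trans -> //]; exact: ltW.
  case: h => [tU|fc]; last first.
    exists s; split => //; last by lra.
    apply: (le_trans s3); apply: le_measure; rewrite ?inE; [exact: mU|exact: mU|].
    apply: setIS => x /=; rewrite !in_itv /= => /andP[-> /lt_trans]; exact.
  exists ((t, t') :: s); split.
  - by rewrite /= at_ tt' lexx.
  - rewrite /= s2 andbT; apply: sub_all s1 => p /and3P[_ _ //].
  - rewrite big_cons /= addrC EFinD.
    apply: (@le_trans _ _ (lebesgue_measure ((U `&` `[a, t[) `|` `[t, t'[))).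
      rewrite measureU //.
        have itvE : lebesgue_measure `[t, t'[%classic = (t' - t)%:E.
          by rewrite lebesgue_measure_itv /= lte_fin tt'.
        by rewrite -itvE; exact: leeD.
        exact: mU.
      apply/seteqP; split => // x [[_ /=]]; rewrite !in_itv /= => /andP[_ xt] /andP[tx _].
      by move: (lt_le_trans xt tx); rewrite ltxx.
    apply: le_measure; rewrite ?inE; [apply: measurableU => //; exact: mU|exact: mU|].
    move=> x [[Ux]|] /=; rewrite !in_itv /= => /andP[h1 h2]; split => //.
    + by rewrite h1 (lt_trans h2).
    + by apply: tU => /=; rewrite in_itv /= h1 ltW.
    + by rewrite h2 (le_trans at_).
  (* For negative [c] the term [c * (t' - t)] lowers the bound although nothing is known about the
     slope inside [U]; the term [|c| * (t' - t)] compensates for it. *)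
  - rewrite !big_cons /=.
    have := ler_norm (f t' - f t); have := ler_norm (- c); rewrite normrN.
    move: (\sum_(_ <- _) _) (\sum_(_ <- _) _) s4 => v1 v2 s4 h1 h2.
    have : 0 <= (c + `|c|) * (t' - t) by rewrite mulr_ge0; lra.
    nra.
have supS : has_sup S by split; [exists a|exists b => t [/andP[]]].
set t0 := sup S.
have at0 : a <= t0 by apply: ub_le_sup; [case: supS|].
have t0b : t0 <= b by apply: ge_sup; [case: supS|move=> t [/andP[]]].
have [d d0 hd] : exists2 d, 0 < d & forall t t', t0 - d < t -> t <= t0 -> t0 <= t' ->
    t' < t0 + d -> t < t' -> (`[t, t'] `<=` U \/ f t' - f t <= c * (t' - t)).
  have [Ut0|nUt0] := pselect (U t0).
    have /nbhs_ballP[d /= d0 dU] : nbhs t0 U by exact: open_nbhs_nbhs.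
    exists d => // t t' h1 h2 h3 h4 _; left => x /=; rewrite in_itv /= => /andP[h5 h6].
    by apply: dU; rewrite /ball /= ltr_distlC; apply/andP; split; lra.
  have at0b : a <= t0 <= b by rewrite at0.
  have [d d0 fd] := fU t0 at0b nUt0.
  exists d => // t t' h1 h2 h3 h4 _; right.
  have [|_ h5] := fd t; first by rewrite ltr_norml; apply/andP; split; lra.
  have [|h6 _] := fd t'; first by rewrite ltr_norml; apply/andP; split; lra.
  move: (h5 h2) (h6 h3); lra.
have [t St t0t] := sup_adherent d0 supS.
have tt0 : t <= t0 by apply: ub_le_sup; [case: supS|].
(* A step across the supremum: [t'] belongs to [S], hence [t' <= t0], which is possible only if the
   minimum is [b]. *)
pose t' := Num.min (t0 + d / 2) b.
have t'b : t' <= b by rewrite /t' ge_min lexx orbT.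
have t't0 : t0 <= t' by rewrite /t' le_min t0b andbT; lra.
have t'd : t' < t0 + d by rewrite /t' gt_min; apply/orP; left; lra.
have St' : S t'.
  have [tt'|t't] := ltP t t'; last by have -> : t' = t by lra.
  by apply: (step t) => //; exact: hd.
have : t' <= t0 by apply: ub_le_sup; [case: supS|].
rewrite {1}/t' ge_min => /orP[|bt0]; first by lra.
by have <- : t' = b by lra.
Qed.

Lemma is_derive_slope f t c e d : is_derive t 1 f d -> d <= c -> 0 < e ->
  exists2 r : R, 0 < r & forall u, `|u - t| < r ->
    (t <= u -> f u - f t <= (c + e) * (u - t)) /\
    (u <= t -> f t - f u <= (c + e) * (t - u)).
Proof.
move=> [fd <-] dc e0.
have : h^-1 *: (f (h *: 1 + t) - f t) @[h --> 0^'] --> 'D_1 f t by exact: fd.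
move=> /cvgrPdist_lt /(_ _ e0) /nbhs_ballP[r /= r0 hr].
exists r => // u ut; have [->|nut] := eqVneq u t.
  by rewrite !subrr mulr0.
have := hr (u - t); rewrite /ball /= sub0r normrN subr_eq0 => /(_ ut nut).
rewrite scaler1 subrK ltr_norml => /andP[h1 _].
pose k := (u - t)^-1 * (f u - f t).
have h2 : k < c + e by rewrite -[k]/((u - t)^-1 *: (f u - f t)); lra.
have fk : f u - f t = k * (u - t) by rewrite /k mulrAC mulVf ?mul1r // subr_eq0.
split=> tu; first by rewrite fk ler_wpM2r ?subr_ge0 // ltW.
have -> : f t - f u = k * (t - u) by rewrite -opprB fk -mulrN opprB.
by rewrite ler_wpM2r ?subr_ge0 // ltW.
Qed.

(** The exceptional null set is covered by an open [U] of tiny measure. Outside [U] the slope is at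
    most [c + e1]; on the intervals used inside [U] absolute continuity makes the variation of [f]
    negligible. *)
Lemma abs_cont_le f a b c : a <= b -> abs_cont a b f ->
  {ae (@lebesgue_measure R), forall t, a <= t <= b ->
     exists2 d, is_derive t 1 f d & d <= c} ->
  f b - f a <= c * (b - a).
Proof.
rewrite le_eqVlt => /orP[/eqP <-|ab]; first by rewrite !subrr mulr0.
move=> fab [A [mA A0 NA]].
apply/ler_addgt0Pr => e e0.
(* Half of [e] pays for the excess slope [e1] over [[a, b]], a quarter for the variation inside [U],
   and a quarter for [C] times the length of the intervals used. *)
pose e1 := e / (2 * (b - a)).
have e10 : 0 < e1 by rewrite divr_gt0 // mulr_gt0 // subr_gt0.
have e4 : 0 < e / 4 by rewrite divr_gt0.
have [d d0 fd] := abs_cont_seq fab e4.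
pose C := `|c + e1|.
have C1 : 0 < 4 * (C + 1) by rewrite mulr_gt0 // ltr_wpDl // /C normr_ge0.
pose dl := Num.min d (e / (4 * (C + 1))).
have dl0 : 0 < dl by rewrite lt_min d0 divr_gt0.
have Afin : (lebesgue_measure A < +oo)%E by rewrite A0 ltry.
have [U [oU AU mU]] := lebesgue_regularity_outer mA Afin dl0.
have mUlt : (lebesgue_measure U < dl%:E)%E.
  apply: le_lt_trans mU.
  have mUA : measurable (U `\` A).
    by apply: measurableD => //; exact: measurable_realfun.open_measurable.
  have : (lebesgue_measure U <= lebesgue_measure (U `\` A) + lebesgue_measure A)%E.
    by rewrite -{1}(setDKU AU); exact: measureU2.
  by rewrite A0 adde0.
have [t tab nUt|s [s1 s2 s3 s4]] := @real_induction_slope U a b (c + e1) f ab oU.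
  have : exists2 d, is_derive t 1 f d & d <= c.
    by apply: contrapT => h; apply: nUt; apply: AU; apply: NA => /(_ tab).
  by move=> [d' fd' d'c]; exact: is_derive_slope fd' d'c e10.
have sdl : \sum_(p <- s) (p.2 - p.1) < dl.
  rewrite -lte_fin; apply: le_lt_trans s3 _; apply: le_lt_trans mUlt.
  apply: le_measure; rewrite ?inE; [|exact: measurable_realfun.open_measurable|exact: subIsetl].
  by apply: measurableI => //; exact: measurable_realfun.open_measurable.
have v2 : \sum_(p <- s) `|f p.2 - f p.1| < e / 4.
  by apply: fd => //; apply: lt_le_trans sdl _; rewrite ge_min lexx.
have v1 : C * \sum_(p <- s) (p.2 - p.1) <= e / 4.
  apply: (@le_trans _ _ ((C + 1) * (e / (4 * (C + 1))))).
    have h1 : \sum_(p <- s) (p.2 - p.1) <= e / (4 * (C + 1)).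
      by apply: ltW; apply: lt_le_trans sdl _; rewrite ge_min lexx orbT.
    have h2 : 0 <= e / (4 * (C + 1)) by rewrite divr_ge0 // ltW.
    have h3 : 0 <= C := normr_ge0 _.
    nra.
  suff -> : (C + 1) * (e / (4 * (C + 1))) = e / 4 by [].
  by field; rewrite gt_eqF //; move: C1; rewrite pmulr_rgt0.
have e1ab : e1 * (b - a) = e / 2.
  by rewrite /e1; field; rewrite gt_eqF // subr_gt0.
apply: (le_trans s4); rewrite -/C mulrDl e1ab; lra.
Qed.

End AbsolutelyContinuous.

(** * Solutions of the variational inequality on [K] *)

Section VariationalInequality.
Variables (R : realType) (m n : nat) (K : set 'M[R]_(m, n)).
Hypotheses (cK : compact K) (K0 : K !=set0) (vK : convex_mx K).

Lemma compact_seq_cluster (s : nat -> 'M[R]_(m, n)) : (forall k, K (s k)) ->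
  exists2 z, K z & forall U, nbhs z U -> forall N, exists2 k, (N <= k)%N & U (s k).
Proof.
move=> Ks; have sK : (s @ \oo) K by exists 0%N => // k _; exact: Ks.
have [z [Kz zs]] := cK _ sK.
exists z => // U zU N.
have [|_ [[k /= Nk <-] Uk]] := zs [set s k | k in [set k | (N <= k)%N]] U _ zU.
  by exists N => // k /= Nk; exists k.
by exists k.
Qed.

Lemma compact_inner_bounded w : exists B, forall z, K z -> inner (z - w) (z - w) <= B.
Proof.
have [c _ cmax] : exists2 c, c \in K & forall t, t \in K -> inner (t - w) (t - w) <= inner (c - w) (c - w).
  apply: compact_EVT_max => //; apply: continuous_subspaceT => y.
  have xB : z - w @[z --> y] --> y - w by apply: (@cvgB _ _ _ (nbhs y)); [exact: cvg_id|exact: cvg_cst].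
  exact: (@cvg_inner _ _ _ _ (nbhs y)).
by exists (inner (c - w) (c - w)) => z /mem_set; exact: cmax.
Qed.

Lemma compact_coord_bounded : exists2 B, 0 <= B & forall z, K z -> forall i j, `|z i j| <= B.
Proof.
have [B KB] := compact_inner_bounded 0; exists (`|B| + 1); first exact: addr_ge0.
move=> z Kz i j; have := le_trans (inner_coord_le (z - 0) i j) (KB z Kz).
rewrite subr0 => h.
rewrite -(ler_pXn2r (n := 2)) ?nnegrE ?addr_ge0 // real_normK ?num_real // (le_trans h) //.
by have := ler_norm B; have := normr_ge0 B; nra.
Qed.

Lemma nbhs_inner_lt (a z w : 'M[R]_(m, n)) c :
  inner (z - w) a < c -> nbhs z [set y | inner (y - w) a < c].
Proof.
move=> h; have : inner (y - w) a @[y --> z] --> inner (z - w) a.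
  apply: (@cvg_inner _ _ _ _ (nbhs z)); last exact: cvg_cst.
  by apply: (@cvgB _ _ _ (nbhs z)); [exact: cvg_id|exact: cvg_cst].
by move=> /cvgr_lt /(_ _ h).
Qed.

(** The new mean lies on the segment from the old mean to the new point, at parameter
    [1 / (k + 2)]. *)
Lemma mean_in (u : nat -> 'M[R]_(m, n)) k : (forall k, K (u k)) ->
  K (k.+1%:R^-1 *: \sum_(i < k.+1) u i).
Proof.
move=> Ku; elim: k => [|k IHk]; first by rewrite big_ord_recl big_ord0 addr0 invr1 scale1r.
rewrite big_ord_recr /=; set S := \sum_(_ < _) _ in IHk *.
have k1 : k.+1%:R != 0 :> R by rewrite pnatr_eq0.
have k2 : k.+2%:R != 0 :> R by rewrite pnatr_eq0.
have -> : k.+2%:R^-1 *: (S + u k.+1) =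
    k.+1%:R^-1 *: S + k.+2%:R^-1 *: (u k.+1 - k.+1%:R^-1 *: S).
  rewrite !scalerDr scalerN addrCA addrC scalerA -scalerBl; congr (_ *: _ + _).
  have k1' : 1 + k%:R != 0 :> R by rewrite -mulrS.
  have k2' : 2 + k%:R != 0 :> R by rewrite -(natrD _ 2 k).
  by rewrite -[k.+2]/(2 + k)%N natrD -[k.+1]/(1 + k)%N natrD; field; rewrite k1' k2'.
by apply: vK => //; rewrite invr_ge0 ler0n invf_le1 ?ltr0n // ler1n.
Qed.

Variables (F : 'M[R]_(m, n) -> 'M[R]_(m, n)) (G : R).
Hypothesis FG : forall z, K z -> inner (F z) (F z) <= G.
Hypothesis skew : forall z w, K z -> K w -> inner (z - w) (F z) = inner (z - w) (F w).

(** Projecting does not increase the distance to a point [w] of [K]; expanding the unprojected step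
    gives the bound. By skewness the right-hand side involves [F w] alone, so it is affine in [z]
    and can be summed over the iterates. *)
Lemma projected_step_le eta z w : K z -> K w -> 0 <= eta ->
  inner (Psi K (z + eta *: F z) - w) (Psi K (z + eta *: F z) - w) - inner (z - w) (z - w)
    - eta ^+ 2 * G <= 2 * eta * inner (z - w) (F w).
Proof.
move=> Kz Kw eta0; set x := z + eta *: F z; have := Psi_vi cK K0 vK x Kw.
set p := Psi K x => h.
have := FG Kz; rewrite -(skew Kz Kw).
have : inner (p - w) (p - w) <= inner (x - w) (x - w).
  have -> : x - w = (x - p) - (w - p) by rewrite opprB addrA subrK.
  rewrite -(opprB w p); move: h (inner_ge0 (x - p)).
  move: (x - p) (w - p) => a b; rewrite !innerE (innerC b a); lra.
have -> : x - w = (z - w) - (- eta) *: F z by rewrite /x scaleNr opprK addrAC.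
rewrite inner_subZ sqrrN => h1 h2.
have : eta ^+ 2 * inner (F z) (F z) <= eta ^+ 2 * G by rewrite ler_wpM2l ?sqr_ge0.
lra.
Qed.

(* Averaged projected-gradient steps: with step 1/(k+1) and (k+1)^2 steps the mean
   violates the inequality by O(1/k), and any cluster point of the means satisfies it. *)
Lemma Minty_exists : exists2 z, K z & forall w, K w -> 0 <= inner (z - w) (F w).
Proof.
have [x0 Kx0] := K0.
pose u eta k := iter k (fun z => Psi K (z + eta *: F z)) x0.
have Ku eta k : K (u eta k) by case: k => //= k; exact: Psi_in.
have sum_le eta w N : 0 <= eta -> K w ->
    - inner (x0 - w) (x0 - w) - N%:R * (eta ^+ 2 * G)
    <= 2 * eta * inner (\sum_(k < N) u eta k - N%:R *: w) (F w).
  move=> eta0 Kw; suff : inner (u eta N - w) (u eta N - w) - inner (x0 - w) (x0 - w)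
     - N%:R * (eta ^+ 2 * G) <= 2 * eta * inner (\sum_(k < N) u eta k - N%:R *: w) (F w).
    by have := inner_ge0 (u eta N - w); lra.
  elim: N => [|N IHN].
    by rewrite big_ord0 scale0r !subr0 /= subrr mul0r inner0l mulr0 subr0.
  have := projected_step_le (Ku eta N) Kw eta0; rewrite -/(u eta N.+1) => h.
  have -> : \sum_(k < N.+1) u eta k - N.+1%:R *: w =
      (\sum_(k < N) u eta k - N%:R *: w) + (u eta N - w).
    by rewrite big_ord_recr /= -addn1 natrD scalerDl scale1r opprD addrACA.
  have -> : N.+1%:R = N%:R + 1 :> R by rewrite -addn1 natrD.
  rewrite [X in _ <= _ * X]innerDl mulrDr mulrDl mul1r.
  apply: le_trans (lerD IHN h); rewrite -[Psi K _]/(u eta N.+1).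
  have telescope (a b c d e : R) : a - c - (d + e) <= b - c - d + (a - b - e) by lra.
  exact: telescope.
(* The predecessor is stored because [mean_in] averages [k.+1] points; the number of points is
   [(k + 1)^2]. With [eta = 1 / (k + 1)] the accumulated error [(k + 1)^2 * eta^2 * G] is just [G],
   and dividing by [2 * eta * (k + 1)^2 = 2 * (k + 1)] sends it to 0. *)
pose N k := (k.+1 ^ 2)%N.-1.
have NE k : (N k).+1 = (k.+1 ^ 2)%N by rewrite /N prednK // expn_gt0.
pose s k := (N k).+1%:R^-1 *: \sum_(i < (N k).+1) u k.+1%:R^-1 i.
have s_le k w : K w -> - ((inner (x0 - w) (x0 - w) + G) / 2 * k.+1%:R^-1) <= inner (s k - w) (F w).
  move=> Kw; have e0 : 0 < k.+1%:R^-1 :> R by rewrite invr_gt0 ltr0n.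
  have := sum_le _ w (N k).+1 (ltW e0) Kw.
  have -> : \sum_(i < (N k).+1) u k.+1%:R^-1 i - (N k).+1%:R *: w = (N k).+1%:R *: (s k - w).
    by rewrite scalerBr /s scalerA divff ?scale1r // pnatr_eq0.
  rewrite innerZl NE natrX; set e := k.+1%:R^-1.
  have -> : k.+1%:R = e^-1 by rewrite /e invrK.
  have e_n0 : e != 0 by rewrite gt_eqF.
  have -> : e^-1 ^+ 2 * (e ^+ 2 * G) = G by field.
  have -> : 2 * e * (e^-1 ^+ 2 * inner (s k - w) (F w)) = e^-1 * (2 * inner (s k - w) (F w)) by field.
  move=> h; have := ler_wpM2l (ltW e0) h; rewrite mulrA mulfV // mul1r -/e.
  move: (inner _ _) (inner _ _) => I A.
  by rewrite (_ : - ((A + G) / 2 * e) = e * (- A - G) / 2) ?ler_pdivrMr ?[I * 2]mulrC //; field.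
have [z Kz zs] := compact_seq_cluster (s := s) (fun k => mean_in _ (Ku _)).
exists z => // w Kw; rewrite leNgt; apply/negP => c0.
set c := inner _ _ in c0.
have /(nbhs_inner_lt (w := w)) zU : inner (z - w) (F w) < c / 2 by rewrite -/c; lra.
pose D := (inner (x0 - w) (x0 - w) + G) / 2.
have : \forall k \near \oo, D * k.+1%:R^-1 < - (c / 2).
  have : D * k.+1%:R^-1 @[k --> \oo] --> D * 0 by apply: cvgMr; exact: cvg_harmonic.
  by rewrite mulr0 => /cvgr_lt; apply; lra.
move=> [M _ hM]; have [k Mk /= sk] := zs _ zU M.
have h := hM _ Mk; have := le_lt_trans (s_le k w Kw) sk.
by rewrite -/D ltrNl => /(lt_trans h); rewrite ltxx.
Qed.

End VariationalInequality.

(** * Trajectories described by inequalities instead of by [Pi] *)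

Section VariationalSolution.
Variables (R : realType) (m n : nat).
Implicit Types (K : set 'M[R]_(m, n)) (x X : R -> 'M[R]_(m, n)).

(** Retains from the projected dynamics only the conclusions of [Pi_vi] and [Pi_norm_le], which
    makes the notion stable under juxtaposing blocks. Membership in [K] is asked at every time, not
    almost every time. *)
Definition vi_solution K x X := [/\ forall t, 0 <= t -> K (x t),
  forall i j T, 0 < T -> abs_cont 0 T (fun t => x t i j) &
  {ae (@lebesgue_measure R), forall t : R, 0 <= t -> exists d : 'M[R]_(m, n),
    [/\ forall i j, is_derive (t : R) 1 (fun u => x u i j) (d i j),
      forall y, K y -> inner (x t - y) d <= inner (x t - y) (X t) &
      inner d d <= inner (X t) (X t)]}].

Lemma lebesgue_aeS (P Q : R -> Prop) : (forall t, P t -> Q t) ->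
  {ae (@lebesgue_measure R), forall t, P t} -> {ae (@lebesgue_measure R), forall t, Q t}.
Proof. exact: (@filterS _ _ (ae_filter_ringOfSetsType (@lebesgue_measure R))). Qed.

Lemma lebesgue_aeI (P Q : R -> Prop) : {ae (@lebesgue_measure R), forall t, P t} ->
  {ae (@lebesgue_measure R), forall t, Q t} ->
  {ae (@lebesgue_measure R), forall t, P t /\ Q t}.
Proof. exact: (@filterI _ _ (ae_filter_ringOfSetsType (@lebesgue_measure R))). Qed.

Lemma ae_itv (Q : R -> Prop) a b : a < b -> {ae (@lebesgue_measure R), forall t : R, Q t} ->
  exists2 t, a < t < b & Q t.
Proof.
move=> ab [A [mA A0 QA]]; apply: contrapT => h.
have : (lebesgue_measure `]a, b[%classic <= lebesgue_measure A)%E.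
  apply: le_measure; rewrite ?inE //.
  by move=> t /=; rewrite in_itv /= => tab; apply: QA => Qt; apply: h; exists t.
by rewrite A0 lebesgue_measure_itv /= lte_fin ab lee_fin subr_le0 leNgt ab.
Qed.

(** If [x t] were outside the closed set at some [t > 0], continuity of the finitely many
    coordinates would keep it outside on an interval to the left of [t], which is not null. Time 0
    has no left neighbourhood in the domain and is covered by the initial condition. *)
Lemma coord_abs_cont_closed_in K x : closed K -> K (x 0) ->
  (forall i j T, 0 < T -> abs_cont 0 T (fun t => x t i j)) ->
  {ae (@lebesgue_measure R), forall t : R, 0 <= t -> K (x t)} ->
  forall t, 0 <= t -> K (x t).
Proof.
move=> clK Kx0 ACx aeK t; rewrite le_eqVlt => /orP[/eqP <- //|t0].
apply: contrapT => nK.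
have /nbhs_ballP[e /= e0 eK] : nbhs (x t) (~` K).
  by apply: open_nbhs_nbhs; split => //; exact: closed_openC.
have [d d0 hd] : exists2 d, 0 < d & forall i j s, 0 <= s -> t - d < s -> s < t -> `|x t i j - x s i j| < e.
  have h ij : exists2 d, 0 < d & forall s, 0 <= s -> t - d < s -> s < t -> `|x t ij.1 ij.2 - x s ij.1 ij.2| < e.
    have [d d0 hd] := ACx ij.1 ij.2 t t0 e e0; exists d => // s s0 ds st.
    (* Absolute continuity with a single interval is continuity. *)
    have := hd 1%N (fun=> s) (fun=> t); rewrite !big_ord1; apply => //; last by lra.
    by move=> k l; rewrite !ord1 eqxx.
  pose D (ij : 'I_m * 'I_n) := sval (cid2 (h ij)).
  have [d0 hd] : (forall ij, 0 < D ij) /\ forall ij s, 0 <= s -> t - D ij < s -> s < t -> `|x t ij.1 ij.2 - x s ij.1 ij.2| < e.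
    by split=> ij; rewrite /D; case: cid2.
  exists (\big[Num.min/1]_ij D ij); first by apply: lt_bigmin.
  move=> i j s s0 ds st; apply: (hd (i, j)) => //; apply: le_lt_trans ds.
  by rewrite lerB // bigmin_le_cond.
have h : Num.max 0 (t - d) < t by rewrite gt_max t0 ltrBlDr ltrDl d0.
have [s /andP[s0 st] Ks] := ae_itv h aeK.
move: s0; rewrite gt_max => /andP[s0 ds].
by apply: (eK (x s)); [split => // i j; exact: hd (ltW s0) ds st|exact: Ks (ltW s0)].
Qed.

Lemma proj_solution_vi K x X : compact K -> convex_mx K -> K (x 0) ->
  proj_solution K x X -> vi_solution K x X.
Proof.
move=> cK vK Kx0 [ACx aex]; have K0 : K !=set0 by exists (x 0).
have clK : closed K by apply: compact_closed => //; exact: norm_hausdorff.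
split=> //.
  apply: coord_abs_cont_closed_in => //; apply: lebesgue_aeS aex => t h t0; by case: (h t0).
apply: lebesgue_aeS aex => t h t0; have [Kxt [dx Dx]] := h t0.
exists (Pi K (x t) (X t)); split.
- move=> i j; rewrite -Dx derive_mx // mxE; apply: derivableP; exact: (derivable_mxP _ _ _).1.
- by move=> y Ky; exact: Pi_vi.
- exact: Pi_norm_le.
Qed.

(** A coordinate of the derivative is bounded by the norm of the driving field, and [abs_cont_le] is
    applied to the coordinate and to its opposite. The starting time [a] is free so that the lemma
    also applies late, where the field of [zh] is small. *)
Lemma vi_solution_lip K x X L a b : vi_solution K x X -> 0 <= L -> 0 <= a ->
  (forall t, a <= t <= b -> inner (X t) (X t) <= L ^+ 2) ->
  forall s t i j, a <= s -> s <= t -> t <= b -> `|x t i j - x s i j| <= L * (t - s).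
Proof.
move=> [_ ACx aex] L0 a0 XL s t i j as_ st tb.
have [ts|ts] := leP t s.
  by have -> : t = s by [lra]; rewrite !subrr normr0 mulr0.
have t0 : 0 < t by rewrite (le_lt_trans a0) // (le_lt_trans as_).
have s0 : 0 <= s := le_trans a0 as_.
have AC : abs_cont s t (fun u => x u i j) by apply: abs_cont_sub (ACx i j t t0).
have dL : {ae (@lebesgue_measure R), forall u : R, s <= u <= t ->
    exists2 d, is_derive (u : R) 1 (fun u => x u i j) d & `|d| <= L}.
  apply: lebesgue_aeS aex => u h /andP[su ut]; have [d [dx _ dX]] := h (le_trans s0 su).
  exists (d i j) => //; rewrite -(ler_pXn2r (n := 2)) ?nnegrE // real_normK ?num_real //.
  apply: le_trans (inner_coord_le _ _ _) (le_trans dX _).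
  by apply: XL; rewrite (le_trans as_) // (le_trans ut).
rewrite ler_norml; apply/andP; split.
  rewrite lerNl opprB addrC -[leLHS](_ : - x t i j - (- x s i j) = _); last by rewrite opprK.
  apply: (abs_cont_le st (abs_contN AC)); apply: lebesgue_aeS dL => u h /h[d du dL].
  by exists (- d); [exact: is_deriveN|rewrite (le_trans (ler_norm _)) // normrN].
apply: (abs_cont_le st AC); apply: lebesgue_aeS dL => u h /h[d du dL].
by exists d => //; rewrite (le_trans (ler_norm _)).
Qed.

Lemma inner_lip (y : R -> 'M[R]_(m, n)) B L : 0 <= L ->
  (forall t, 0 <= t -> forall i j, `|y t i j| <= B) ->
  (forall s t i j, 0 <= s -> s <= t -> `|y t i j - y s i j| <= L * (t - s)) ->
  exists2 L', 0 < L' & forall s t, 0 <= s -> s <= t ->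
    `|inner (y t) (y t) - inner (y s) (y s)| <= L' * (t - s).
Proof.
move=> L0 yB yL.
pose L1 := \sum_(i < m) \sum_(j < n) (L * (B + B)).
exists (`|L1| + 1); first by rewrite ltr_wpDl.
move=> s t s0 st; have t0 := le_trans s0 st; have ts : 0 <= t - s by rewrite subr_ge0.
apply: (@le_trans _ _ (L1 * (t - s))); last first.
  by rewrite ler_wpM2r // (le_trans (ler_norm _)) // lerDl.
rewrite /inner /L1 -sumrB mulr_suml (le_trans (ler_norm_sum _ _ _)) //.
apply: ler_sum => i _; rewrite -sumrB mulr_suml (le_trans (ler_norm_sum _ _ _)) //.
apply: ler_sum => j _; rewrite -!expr2 subr_sqr normrM mulrAC.
by rewrite ler_pM // ?yL // (le_trans (ler_normD _ _)) // lerD ?yB.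
Qed.

Lemma is_derive_inner (y : R -> 'M[R]_(m, n)) (t : R) (d : 'M[R]_(m, n)) :
  (forall i j, is_derive (t : R) 1 (fun u => y u i j) (d i j)) ->
  is_derive (t : R) 1 (fun u => inner (y u) (y u)) (2 * inner (y t) d).
Proof.
move=> yd.
have -> : (fun u => inner (y u) (y u)) =
    \sum_(i < m) \sum_(j < n) ((fun u => y u i j) * (fun u => y u i j)).
  apply/funext => u; rewrite fct_sumE /inner; apply: eq_bigr => i _.
  by rewrite fct_sumE.
rewrite /inner mulr_sumr.
apply: is_derive_sum => i; rewrite mulr_sumr; apply: is_derive_sum => j.
apply: is_derive_eq.
by rewrite /GRing.scale /= mulrC; ring.
Qed.

End VariationalSolution.

(** * Convergence of the proximal flow of a skew field *)

Section ProximalFlow.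
Variables (R : realType) (m n : nat) (K : set 'M[R]_(m, n)).
Hypotheses (cK : compact K) (vK : convex_mx K).
Variables (F : 'M[R]_(m, n) -> 'M[R]_(m, n)) (G rho : R).
Hypothesis FG : forall z, K z -> inner (F z) (F z) <= G.
Hypothesis skew : forall z w, K z -> K w -> inner (z - w) (F z) = inner (z - w) (F w).
Hypothesis rho0 : 0 < rho.
Variables z zh : R -> 'M[R]_(m, n).
Hypothesis zsol : vi_solution K z (fun t => F (z t) - rho^-1 *: (z t - zh t)).
Hypothesis zhsol : vi_solution K zh (fun t => rho^-1 *: (z t - zh t)).

Let Kz t : 0 <= t -> K (z t). Proof. by case: zsol => h _ _; exact: h. Qed.
Let Kzh t : 0 <= t -> K (zh t). Proof. by case: zhsol => h _ _; exact: h. Qed.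

Let K0 : K !=set0. Proof. by exists (z 0); exact: Kz. Qed.

Let E t := inner (z t - zh t) (z t - zh t).
Let V w t := inner (z t - w) (z t - w) + inner (zh t - w) (zh t - w).

Lemma inner_sub_le (a b : 'M[R]_(m, n)) : inner (a - b) (a - b) <= 2 * (inner a a + inner b b).
Proof. by have := inner_ge0 (a + b); rewrite !innerE (innerC b a); lra. Qed.

Lemma flow_lip : exists2 L, 0 <= L & forall s t i j, 0 <= s -> s <= t ->
  `|z t i j - z s i j| <= L * (t - s) /\ `|zh t i j - zh s i j| <= L * (t - s).
Proof.
have [B0 KB0] := compact_inner_bounded cK K0 0.
have KB y : K y -> inner y y <= B0 by move=> /KB0; rewrite subr0.
have G0 : 0 <= G := le_trans (inner_ge0 _) (FG (Kz (lexx 0))).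
have B00 : 0 <= B0 := le_trans (inner_ge0 _) (KB _ (Kz (lexx 0))).
have E4 t : 0 <= t -> E t <= 4 * B0.
  move=> t0; have := inner_sub_le (z t) (zh t); have := KB _ (Kz t0); have := KB _ (Kzh t0).
  rewrite -/(E t); lra.
pose q := rho^-1 ^+ 2 * (4 * B0).
have q0 : 0 <= q by rewrite mulr_ge0 ?sqr_ge0 // mulr_ge0.
have qE t : 0 <= t -> inner (rho^-1 *: (z t - zh t)) (rho^-1 *: (z t - zh t)) <= q.
  by move=> t0; rewrite innerZl innerZr mulrA -expr2 ler_wpM2l ?sqr_ge0 // E4.
pose Q := 2 * (G + q); have qQ : q <= Q by rewrite /Q; lra.
have Q0 : 0 <= Q := le_trans q0 qQ.
have QL : Q <= (Q + 1) ^+ 2 by nra.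
(* [Q] bounds the squared speeds; since [Q <= (Q + 1) ^+ 2], the number [Q + 1] bounds the speeds
   without extracting a square root. *)
exists (Q + 1); first by lra.
move=> s t i j s0 st; split.
  apply: (vi_solution_lip zsol _ (lexx 0) (b := t)) => //; first by lra.
  move=> u /andP[u0 _]; apply: le_trans QL; apply: le_trans (inner_sub_le _ _) _.
  by rewrite /Q ler_pM2l // lerD //; [apply: FG; exact: Kz|exact: qE].
apply: (vi_solution_lip zhsol _ (lexx 0) (b := t)) => //; first by lra.
by move=> u /andP[u0 _]; apply: le_trans QL; apply: le_trans qQ; exact: qE.
Qed.

Lemma sqdist_flow_lip (x : R -> 'M[R]_(m, n)) w : K w -> (forall t, 0 <= t -> K (x t)) ->
  (exists2 L, 0 <= L & forall s t i j, 0 <= s -> s <= t -> `|x t i j - x s i j| <= L * (t - s)) ->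
  exists2 L, 0 < L & forall s t, 0 <= s -> s <= t ->
    `|inner (x t - w) (x t - w) - inner (x s - w) (x s - w)| <= L * (t - s).
Proof.
move=> Kw Kx [L L0 xL]; have [B B0 KB] := compact_coord_bounded cK K0.
apply: (@inner_lip _ _ _ (fun t => x t - w) (B + B) L) => // [t t0 i j|s t i j s0 st].
  by rewrite !mxE (le_trans (ler_normB _ _)) // lerD //; apply: KB => //; exact: Kx.
rewrite !mxE opprD addrACA subrr addr0; exact: xL.
Qed.

(** In the derivative of [V w] the angle inequality replaces both velocities by their driving
    fields, skewness replaces [F (z t)] by [F w], and the two proximal terms combine to
    [- 2 / rho * E t]. Nothing is assumed of [w] beyond membership in [K]. *)
Lemma V_slope w a b c : K w -> 0 <= a -> a <= b ->
  (forall t, a <= t <= b -> 2 * inner (z t - w) (F w) - 2 / rho * E t <= c) ->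
  V w b - V w a <= c * (b - a).
Proof.
move=> Kw a0 ab hc; have [L L0 zL] := flow_lip.
have [L1 L10 h1] : exists2 L, 0 < L & forall s t, 0 <= s -> s <= t ->
    `|inner (z t - w) (z t - w) - inner (z s - w) (z s - w)| <= L * (t - s).
  by apply: sqdist_flow_lip => //; exists L => // s t i j s0 st; case: (zL s t i j s0 st).
have [L2 L20 h2] : exists2 L, 0 < L & forall s t, 0 <= s -> s <= t ->
    `|inner (zh t - w) (zh t - w) - inner (zh s - w) (zh s - w)| <= L * (t - s).
  by apply: sqdist_flow_lip => //; exists L => // s t i j s0 st; case: (zL s t i j s0 st).
apply: abs_cont_le => //.
  apply: (@lip_abs_cont _ _ _ _ (L1 + L2)) => s t as_ st tb.
  have s0 := le_trans a0 as_; rewrite /V opprD addrACA mulrDl (le_trans (ler_normD _ _)) //.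
  by rewrite lerD ?h1 ?h2.
have [[_ _ z1] [_ _ z2]] := (zsol, zhsol).
apply: lebesgue_aeS (lebesgue_aeI z1 z2) => t [d1 d2] /andP[at_ tb].
have t0 := le_trans a0 at_.
have [d [dz dvi _]] := d1 t0; have [dh [dzh dhvi _]] := d2 t0.
exists (2 * inner (z t - w) d + 2 * inner (zh t - w) dh).
  have shift (x : R -> 'M[R]_(m, n)) (e : 'M[R]_(m, n)) :
      (forall i j, is_derive (t : R) 1 (fun u => x u i j) (e i j)) ->
      is_derive (t : R) 1 (fun u => inner (x u - w) (x u - w)) (2 * inner (x t - w) e).
    move=> xe; apply: (is_derive_inner (y := fun u => x u - w)) => i j.
    have -> : (fun u => (x u - w) i j) = (fun u => x u i j) - cst (w i j).
      by apply/funext => u; rewrite !mxE.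
    by rewrite -[e i j]subr0; apply: is_deriveB.
  by apply: is_deriveD; exact: shift.
apply: le_trans (hc t _); last by rewrite at_ tb.
have := dvi w Kw; have := dhvi w Kw; rewrite -(skew (Kz t0) Kw).
rewrite !innerDr !innerNr !innerZr.
have EE : E t = inner (z t - w) (z t - zh t) - inner (zh t - w) (z t - zh t).
  by rewrite -innerNl -innerDl opprB addrA subrK.
move=> i1 i2.
have -> : 2 / rho * E t = 2 * (rho^-1 * inner (z t - w) (z t - zh t))
   - 2 * (rho^-1 * inner (zh t - w) (z t - zh t)) by rewrite EE; ring.
move: i1 i2; move: (rho^-1 * inner (z t - w) _) (rho^-1 * inner (zh t - w) _) => p q; lra.
Qed.

(** A Barbalat-type argument: [E] is Lipschitz, so a large late value of [E] persists for a fixed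
    duration and costs [V w] a fixed amount, whereas [V w] is nonincreasing and bounded below. *)
Lemma gap_vanishes e : 0 < e -> exists2 T, 0 <= T & forall t, T <= t -> E t < e.
Proof.
have [w Kw wM] := Minty_exists cK K0 vK FG skew.
have Vle s t : 0 <= s -> s <= t -> V w t <= V w s.
  move=> s0 st; rewrite -subr_le0 -(mul0r (t - s)); apply: V_slope => // u /andP[su _].
  have u0 := le_trans s0 su.
  have := wM _ (Kz u0); rewrite -(opprB (z u) w) innerNl (skew (Kz u0) Kw) => h.
  have : 0 <= 2 / rho * E u by rewrite mulr_ge0 ?inner_ge0 // divr_ge0 // ltW.
  lra.
have [L L0 zL] := flow_lip.
have [B B0 KB] := compact_coord_bounded cK K0.
have [LE LE0 EL] : exists2 L, 0 < L & forall s t, 0 <= s -> s <= t -> `|E t - E s| <= L * (t - s).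
  apply: (@inner_lip _ _ _ (fun t => z t - zh t) (B + B) (L + L)) => // [||s t i j s0 st].
  - exact: addr_ge0.
  - move=> t t0 i j; rewrite !mxE (le_trans (ler_normB _ _)) // lerD //; apply: KB.
      exact: Kz.
    exact: Kzh.
  - have [h1 h2] := zL s t i j s0 st; rewrite !mxE.
    have -> : z t i j - zh t i j - (z s i j - zh s i j) =
      (z t i j - z s i j) - (zh t i j - zh s i j) by ring.
    by rewrite (le_trans (ler_normB _ _)) // mulrDl lerD.
move=> e0; pose tau := e / (2 * LE).
have tau0 : 0 < tau by rewrite divr_gt0 // mulr_gt0.
have LEtau : LE * tau = e / 2 by rewrite /tau; field; rewrite gt_eqF.
(* On an interval of length [tau] the gap stays at least [e / 2], so [V w] drops at rate at least
   [e / rho], in total [kappa]; after a time [T] at which [V w] is within [kappa] of its infimum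
   this is impossible. *)
pose kappa := e / rho * tau.
have kappa0 : 0 < kappa by rewrite mulr_gt0 // divr_gt0.
pose A := [set V w t | t in [set t : R | 0 <= t]].
have infA : has_inf A.
  split; first by exists (V w 0); exists 0 => /=.
  by exists 0 => _ [t _ <-]; rewrite addr_ge0 // inner_ge0.
have [_ [T /= T0 <-] VT] := inf_adherent kappa0 infA.
exists T => // t Tt; rewrite ltNge; apply/negP => eE.
have t0 := le_trans T0 Tt.
have ttau : t <= t + tau by rewrite lerDl ltW.
have : V w (t + tau) - V w t <= - (e / rho) * (t + tau - t).
  apply: V_slope => // u /andP[tu utau]; have u0 := le_trans t0 tu.
  have := wM _ (Kz u0); rewrite -(opprB (z u) w) innerNl (skew (Kz u0) Kw) => h.
  have Eu : e / 2 <= E u.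
    have := EL t u t0 tu; have : LE * (u - t) <= e / 2 by rewrite -LEtau ler_pM2l //; lra.
    by rewrite ler_norml => h1 /andP[h2 _]; lra.
  have : 2 / rho * (e / 2) <= 2 / rho * E u by rewrite ler_wpM2l // divr_ge0 // ltW.
  have -> : 2 / rho * (e / 2) = e / rho by field; rewrite gt_eqF.
  by move: (2 / rho * E u) (e / rho) => p q; lra.
have -> : - (e / rho) * (t + tau - t) = - kappa by rewrite /kappa; ring.
have := Vle T t T0 Tt.
have : inf A <= V w (t + tau).
  by apply: ge_inf; [case: infA|exists (t + tau) => //=; lra].
lra.
Qed.

(* Since the gap [z - zh] vanishes, [zh] is eventually slow, so [z] lingers near a cluster
   point [zb] for as long as desired; were the inequality violated at [zb], [V w] would
   become negative meanwhile. *)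
Lemma cluster_Minty zb : K zb ->
  (forall U, nbhs zb U -> forall N, exists2 k : nat, (N <= k)%N & U (z k%:R)) ->
  forall w, K w -> 0 <= inner (zb - w) (F w).
Proof.
move=> Kzb zbcl w Kw; rewrite leNgt; apply/negP => c0.
set c := inner _ _ in c0.
have /(nbhs_inner_lt (w := w)) /nbhs_ballP[eta /= eta0 etaU] : inner (zb - w) (F w) < c / 2.
  by rewrite -/c; lra.
have [B VB] : exists B, forall t, 0 <= t -> V w t <= B.
  have [B KB] := compact_inner_bounded cK K0 w; exists (B + B) => t t0.
  by apply: lerD; apply: KB; [exact: Kz|exact: Kzh].
have B0 : 0 <= B by apply: le_trans (VB 0 _) => //; rewrite addr_ge0 // inner_ge0.
(* While [<z - w, F w>] stays below [c / 2], [V w] has slope at most [c]; over a duration [T] it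
   drops by [B + 1], more than its upper bound [B]. *)
pose T := (B + 1) / - c.
have T0 : 0 < T by rewrite divr_gt0 //; lra.
pose speed := eta / (4 * T).
have speed0 : 0 < speed by rewrite divr_gt0 // mulr_gt0.
(* The first threshold keeps each coordinate of [z - zh] below [eta / 4]; the second keeps the field
   of [zh], which is [rho^-1] times the gap, below [speed], so that [zh] moves by at most [eta / 4]
   during [T]. *)
have min0 : 0 < Num.min ((eta / 4) ^+ 2) ((rho * speed) ^+ 2).
  by rewrite lt_min; apply/andP; split; apply: exprn_gt0; [exact: divr_gt0|exact: mulr_gt0].
have [T1 T10 ET1] := gap_vanishes min0.
have eta40 : 0 < eta / 4 by rewrite divr_gt0.
have gap t i j : T1 <= t -> `|z t i j - zh t i j| < eta / 4.
  move=> /ET1; rewrite lt_min => /andP[h _].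
  have := le_lt_trans (inner_coord_le (z t - zh t) i j) h; rewrite !mxE => {}h.
  by rewrite -(ltr_pXn2r (n := 2)) ?nnegrE // ?real_normK ?num_real // ltW.
have slow s t i j : T1 <= s -> s <= t -> `|zh t i j - zh s i j| <= speed * (t - s).
  move=> T1s st; apply: (vi_solution_lip zhsol _ _ (a := s) (b := t)) => //.
  - exact: ltW.
  - exact: le_trans T1s.
  move=> u /andP[su _]; have := ET1 u (le_trans T1s su); rewrite lt_min => /andP[_ h].
  rewrite innerZl innerZr mulrA -expr2; have -> : speed ^+ 2 = rho^-1 ^+ 2 * (rho * speed) ^+ 2.
    by field; rewrite gt_eqF.
  by rewrite ler_wpM2l ?sqr_ge0 // ltW.
have speedT : speed * T = eta / 4 by rewrite /speed; field; rewrite gt_eqF.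
have [N T1N] : exists N : nat, T1 <= N%:R.
  by exists (Num.bound T1); rewrite ltW // archi_boundP.
have [k Nk zk] := zbcl _ (nbhsx_ballx zb (eta / 4) eta40) N.
pose t := k%:R : R.
have T1t : T1 <= t by rewrite (le_trans T1N) // ler_nat.
have t0 := le_trans T10 T1t.
(* Four displacements of at most [eta / 4] lead from [zb] to [z u], by way of [z t], [zh t] and
   [zh u]; three of them are strictly smaller. *)
have stay u : t <= u <= t + T -> inner (z u - w) (F w) < c / 2.
  move=> /andP[tu uT]; apply: etaU; split => // i j; rewrite /ball /=.
  have g1 := gap u i j (le_trans T1t tu).
  have g2 := gap t i j T1t.
  have g3 : `|zh u i j - zh t i j| <= eta / 4.
    by rewrite (le_trans (slow _ _ _ _ T1t tu)) // -speedT ler_pM2l //; lra.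
  have g4 : `|zb i j - z t i j| < eta / 4 by case: zk => _ /(_ i j).
  move: g1 g2 g3 g4; rewrite !ltr_norml !ler_norml => /andP[? ?] /andP[? ?] /andP[? ?] /andP[? ?].
  by apply/andP; split; lra.
have : V w (t + T) - V w t <= c * (t + T - t).
  apply: V_slope => //; first by rewrite lerDl ltW.
  move=> u tuT; have u0 : 0 <= u by case/andP: tuT => tu _; exact: le_trans tu.
  have : 0 <= 2 / rho * E u by rewrite mulr_ge0 ?inner_ge0 // divr_ge0 // ltW.
  by have := stay u tuT; lra.
have -> : c * (t + T - t) = - (B + 1).
  by rewrite /T; field; rewrite lt_eqF.
have : 0 <= V w (t + T) by rewrite addr_ge0 // inner_ge0.
have := VB t t0; lra.
Qed.

Theorem proximal_flow_cvg : exists zb, [/\ K zb, forall w, K w -> 0 <= inner (zb - w) (F w),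
  z t @[t --> +oo] --> zb & zh t @[t --> +oo] --> zb].
Proof.
have [zb Kzb zbcl] := compact_seq_cluster cK (s := fun k => z k%:R) (fun k => Kz (ler0n _ k)).
have zbM := cluster_Minty Kzb zbcl.
have V0 e : 0 < e -> exists2 T, 0 <= T & forall t, T <= t -> V zb t < e.
  (* The fractions come from [|zh - zb|^2 <= 2 * (|z - zb|^2 + |z - zh|^2)], whence
     [V zb t < 3 * (e / 6) + 2 * (e / 4) = e]. *)
  move=> e0; have [T1 T10 ET1] := gap_vanishes (e := e / 4) (divr_gt0 e0 (ltr0n _ 4)).
  have [N T1N] : exists N : nat, T1 <= N%:R.
    by exists (Num.bound T1); rewrite ltW // archi_boundP.
  have : nbhs zb [set y | inner (y - zb) (y - zb) < e / 6].
    have h : inner (y - zb) (y - zb) @[y --> zb] --> inner (zb - zb) (zb - zb).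
      have yB : y - zb @[y --> zb] --> zb - zb.
        by apply: (@cvgB _ _ _ (nbhs zb)); [exact: cvg_id|exact: cvg_cst].
      exact: (@cvg_inner _ _ _ _ (nbhs zb)).
    by move: h; rewrite subrr inner0l => /cvgr_lt; apply; rewrite divr_gt0.
  move=> /zbcl /(_ N)[k Nk /= zk]; pose t := k%:R : R.
  have T1t : T1 <= t by rewrite (le_trans T1N) // ler_nat.
  have t0 := le_trans T10 T1t.
  exists t => // u tu; apply: (@le_lt_trans _ _ (V zb t)).
    rewrite -subr_le0 -(mul0r (u - t)); apply: V_slope => // s /andP[ts _].
    have s0 := le_trans t0 ts.
    have := zbM _ (Kz s0); rewrite -(opprB (z s) zb) innerNl (skew (Kz s0) Kzb) => h.
    have : 0 <= 2 / rho * E s by rewrite mulr_ge0 ?inner_ge0 // divr_ge0 // ltW.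
    lra.
  have := ET1 t T1t; rewrite /E => h.
  have := inner_sub_le (z t - zb) (z t - zh t).
  have -> : z t - zb - (z t - zh t) = zh t - zb by rewrite opprB addrC addrA subrK.
  rewrite /V; move: zk h; rewrite -/t; lra.
have cvgV (x : R -> 'M[R]_(m, n)) : (forall t, inner (x t - zb) (x t - zb) <= V zb t) ->
    x t @[t --> +oo] --> zb.
  move=> xV; apply: cvg_mx_coord => i j; apply/cvgrPdist_lt => e e0.
  have [T T0 VT] := V0 (e ^+ 2) (exprn_gt0 _ e0).
  near=> t; have /VT h : T <= t.
    by near: t; apply: nbhs_pinfty_ge; rewrite num_real.
  rewrite -normrN opprB -(ltr_pXn2r (n := 2)) ?nnegrE // ?(ltW e0) // real_normK ?num_real //.
  apply: le_lt_trans h; apply: le_trans (xV t).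
  by have := inner_coord_le (x t - zb) i j; rewrite !mxE.
exists zb; split => //; apply: cvgV => t.
  by rewrite lerDl inner_ge0.
by rewrite lerDr inner_ge0.
Unshelve. all: by end_near. Qed.

End ProximalFlow.

(** * Product sets and block trajectories encoded as row vectors *)

Section Blocks.
Variable R : realType.

Lemma cvg_sumr (I T : Type) (r : seq I) (F : set_system T) (FF : Filter F)
    (f : I -> T -> R) (a : I -> R) : (forall i, f i t @[t --> F] --> a i) ->
  \sum_(i <- r) f i t @[t --> F] --> \sum_(i <- r) a i.
Proof. by move=> fa; apply: cvg_big => [|i _]; [exact: add_continuous|exact: fa]. Qed.

Lemma cvg_coord (T : Type) (F : set_system T) (FF : Filter F) m n
    (f : T -> 'M[R]_(m, n)) (a : 'M[R]_(m, n)) i j :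
  f @ F --> a -> f t i j @[t --> F] --> a i j.
Proof.
by move=> fa; apply: (cvg_comp f (fun M : 'M[R]_(m, n) => M i j) fa); exact: coord_continuous.
Qed.

Section Cvg.
Variables (T : Type) (F : set_system T) (FF : Filter F).

Lemma cvg_row_mx m n1 n2 (f : T -> 'M[R]_(m, n1)) (g : T -> 'M[R]_(m, n2))
    (a : 'M[R]_(m, n1)) (b : 'M[R]_(m, n2)) :
  f @ F --> a -> g @ F --> b -> row_mx (f t) (g t) @[t --> F] --> row_mx a b.
Proof.
move=> fa gb; apply: cvg_mx_coord => i j; rewrite mxE; under eq_fun do rewrite mxE.
by case: (fintype.split j) => k; exact: cvg_coord.
Qed.

Lemma cvg_lsubmx m n1 n2 (f : T -> 'M[R]_(m, n1 + n2)) (a : 'M[R]_(m, n1 + n2)) :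
  f @ F --> a -> lsubmx (f t) @[t --> F] --> lsubmx a.
Proof.
move=> fa; apply: cvg_mx_coord => i j; rewrite mxE; under eq_fun do rewrite mxE.
exact: cvg_coord.
Qed.

Lemma cvg_rsubmx m n1 n2 (f : T -> 'M[R]_(m, n1 + n2)) (a : 'M[R]_(m, n1 + n2)) :
  f @ F --> a -> rsubmx (f t) @[t --> F] --> rsubmx a.
Proof.
move=> fa; apply: cvg_mx_coord => i j; rewrite mxE; under eq_fun do rewrite mxE.
exact: cvg_coord.
Qed.

Lemma cvg_mxvec m n (f : T -> 'M[R]_(m, n)) (a : 'M[R]_(m, n)) :
  f @ F --> a -> mxvec (f t) @[t --> F] --> mxvec a.
Proof.
move=> fa; apply: cvg_mx_coord => i j; rewrite ord1; case/mxvec_indexP: j => k l.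
by rewrite mxvecE; under eq_fun do rewrite mxvecE; exact: cvg_coord.
Qed.

Lemma cvg_vec_mx m n (f : T -> 'rV[R]_(m * n)) (a : 'rV[R]_(m * n)) :
  f @ F --> a -> vec_mx (f t) @[t --> F] --> vec_mx a.
Proof.
move=> fa; apply: cvg_mx_coord => i j; rewrite mxE; under eq_fun do rewrite mxE.
exact: cvg_coord.
Qed.

End Cvg.

Lemma inner_row_mx m n1 n2 (a c : 'M[R]_(m, n1)) (b d : 'M[R]_(m, n2)) :
  inner (row_mx a b) (row_mx c d) = inner a c + inner b d.
Proof.
rewrite /inner -big_split /=; apply: eq_bigr => i _; rewrite big_split_ord /=.
by congr (_ + _); apply: eq_bigr => j _; rewrite ?row_mxEl ?row_mxEr.
Qed.

Lemma inner_mxvec m n (a b : 'M[R]_(m, n)) : inner (mxvec a) (mxvec b) = inner a b.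
Proof.
rewrite /inner big_ord1 (reindex _ (curry_mxvec_bij m n)) /= pair_bigA /=.
by apply: eq_bigr => -[i j] _; rewrite /= !mxvecE.
Qed.

Definition prod_mx m n1 n2 (K1 : set 'M[R]_(m, n1)) (K2 : set 'M[R]_(m, n2)) :=
  [set z : 'M[R]_(m, n1 + n2) | K1 (lsubmx z) /\ K2 (rsubmx z)].

Definition vec_set m n (K : set 'M[R]_(m, n)) := [set z : 'rV[R]_(m * n) | K (vec_mx z)].

Lemma prod_mx_row m n1 n2 (K1 : set 'M[R]_(m, n1)) (K2 : set 'M[R]_(m, n2)) a b :
  K1 a -> K2 b -> prod_mx K1 K2 (row_mx a b).
Proof. by move=> h1 h2; split; rewrite ?row_mxKl ?row_mxKr. Qed.

Lemma vec_set_mxvec m n (K : set 'M[R]_(m, n)) a : K a -> vec_set K (mxvec a).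
Proof. by rewrite /vec_set /= mxvecK. Qed.

Lemma compact_prod_mx m n1 n2 (K1 : set 'M[R]_(m, n1)) (K2 : set 'M[R]_(m, n2)) :
  compact K1 -> compact K2 -> compact (prod_mx K1 K2).
Proof.
move=> c1 c2; have c12 := compact_setX c1 c2.
have -> : prod_mx K1 K2 = [set row_mx p.1 p.2 | p in K1 `*` K2].
  apply/seteqP; split => [z [z1 z2]|_ [[a b] [h1 h2] <-]]; last exact: prod_mx_row.
  by exists (lsubmx z, rsubmx z); rewrite //= hsubmxK.
apply: continuous_compact => //; apply: continuous_subspaceT => -[a b].
apply: (@cvg_row_mx _ (nbhs (a, b))); [exact: cvg_fst|exact: cvg_snd].
Qed.

Lemma compact_vec_set m n (K : set 'M[R]_(m, n)) : compact K -> compact (vec_set K).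
Proof.
move=> cK; have -> : vec_set K = [set mxvec x | x in K].
  apply/seteqP; split => [z Kz|_ [x Kx <-]]; last exact: vec_set_mxvec.
  by exists (vec_mx z); rewrite // vec_mxK.
apply: continuous_compact => //; apply: continuous_subspaceT => x.
exact: (@cvg_mxvec _ (nbhs x)).
Qed.

Lemma convex_prod_mx m n1 n2 (K1 : set 'M[R]_(m, n1)) (K2 : set 'M[R]_(m, n2)) :
  convex_mx K1 -> convex_mx K2 -> convex_mx (prod_mx K1 K2).
Proof.
move=> h1 h2 x y t [x1 x2] [y1 y2] t01; rewrite /prod_mx /= !(linearD, linearZ, linearN) /=.
by split; [exact: h1|exact: h2].
Qed.

Lemma convex_vec_set m n (K : set 'M[R]_(m, n)) : convex_mx K -> convex_mx (vec_set K).
Proof.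
by move=> h x y t Kx Ky t01; rewrite /vec_set /= linearD linearZ /= linearB; exact: h.
Qed.

Lemma row_mx_coord (T : Type) m n1 n2 (x1 : T -> 'M[R]_(m, n1)) (x2 : T -> 'M[R]_(m, n2)) i j :
  (fun t => row_mx (x1 t) (x2 t) i j) =
  match fintype.split j with inl k => fun t => x1 t i k | inr k => fun t => x2 t i k end.
Proof. by apply/funext => t; rewrite mxE; case: (fintype.split j). Qed.

Lemma mxvec_coord (T : Type) m n (x : T -> 'M[R]_(m, n)) i j :
  (fun t => mxvec (x t) 0 (mxvec_index i j)) = (fun t => x t i j).
Proof. by apply/funext => t; rewrite mxvecE. Qed.

(** Inner products add over blocks, so the angle inequality and the norm bound of the two components
    simply add up, outside the union of two null sets. *)
Lemma vi_solution_row_mx m n1 n2 (K1 : set 'M[R]_(m, n1)) (K2 : set 'M[R]_(m, n2)) x1 X1 x2 X2 :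
  vi_solution K1 x1 X1 -> vi_solution K2 x2 X2 ->
  vi_solution (prod_mx K1 K2) (fun t => row_mx (x1 t) (x2 t)) (fun t => row_mx (X1 t) (X2 t)).
Proof.
move=> [k1 a1 d1] [k2 a2 d2]; split.
- by move=> t t0; apply: prod_mx_row; [exact: k1|exact: k2].
- move=> i j T T0; rewrite row_mx_coord.
  by case: (fintype.split j) => k; [exact: a1|exact: a2].
apply: lebesgue_aeS (lebesgue_aeI d1 d2) => t [{}d1 {}d2] t0.
have [e1 [p1 q1 r1]] := d1 t0; have [e2 [p2 q2 r2]] := d2 t0.
exists (row_mx e1 e2); split.
- move=> i j; rewrite mxE row_mx_coord.
  by case: (fintype.split j) => k; [exact: p1|exact: p2].
- move=> y [y1 y2]; rewrite -(hsubmxK y) opp_row_mx add_row_mx !inner_row_mx.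
  by rewrite lerD ?q1 ?q2.
- by rewrite !inner_row_mx lerD.
Qed.

Lemma vi_solution_mxvec m n (K : set 'M[R]_(m, n)) x X : vi_solution K x X ->
  vi_solution (vec_set K) (fun t => mxvec (x t)) (fun t => mxvec (X t)).
Proof.
move=> [k a d]; split.
- by move=> t t0; apply: vec_set_mxvec; exact: k.
- move=> i j T T0; rewrite ord1; case/mxvec_indexP: j => p q.
  by rewrite mxvec_coord; exact: a.
apply: lebesgue_aeS d => t d t0; have [e [h1 h2 h3]] := d t0.
exists (mxvec e); split.
- move=> i j; rewrite ord1; case/mxvec_indexP: j => p q; rewrite mxvecE.
  by rewrite mxvec_coord; exact: h1.
- by move=> y Ky; rewrite -(vec_mxK y) -linearB !inner_mxvec; exact: h2.
- by rewrite !inner_mxvec.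
Qed.

Lemma continuous_inner_bounded m n m' n' (K : set 'M[R]_(m, n)) (F : 'M[R]_(m, n) -> 'M[R]_(m', n')) :
  compact K -> K !=set0 -> continuous F -> exists G, forall z, K z -> inner (F z) (F z) <= G.
Proof.
move=> cK K0 cF.
have [c _ cmax] : exists2 c, c \in K & forall t, t \in K -> inner (F t) (F t) <= inner (F c) (F c).
  apply: compact_EVT_max => //; apply: continuous_subspaceT => y.
  by apply: (@cvg_inner _ _ _ _ (nbhs y)); exact: cF.
by exists (inner (F c) (F c)) => z /mem_set; exact: cmax.
Qed.

Lemma closed_forall_le (I : Type) (T : topologicalType) (f : I -> T -> R) c :
  (forall i, continuous (f i)) -> closed [set x | forall i, f i x <= c].
Proof.
move=> cf; have -> : [set x | forall i, f i x <= c] = \bigcap_i (f i @^-1` [set y | y <= c]).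
  by apply/seteqP; split => [x h i _|x h i]; [exact: h|exact: (h i)].
by apply: closed_bigI => i _; apply: closed_comp => [x _|]; [exact: cf|exact: closed_le].
Qed.

End Blocks.

(** * Convexity and compactness of the simplex and of the multiplier sets *)

Section FeasibleSets.
Variable R : realType.

Lemma inner_delta m n (i : 'I_m) (j : 'I_n) (x : 'M[R]_(m, n)) : inner (delta_mx i j) x = x i j.
Proof.
rewrite /inner (bigD1 i) //= (bigD1 j) //= mxE !eqxx mul1r.
rewrite big1 ?addr0 => [|k /negPf kj]; last by rewrite mxE eqxx kj mul0r.
rewrite big1 ?addr0 // => k /negPf ki; rewrite big1 // => l _.
by rewrite mxE ki mul0r.
Qed.

Lemma inner_const1 m n (x : 'M[R]_(m, n)) : inner x (const_mx 1) = \sum_i \sum_j x i j.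
Proof. by do 2 (apply: eq_bigr => ? _); rewrite mxE mulr1. Qed.

Lemma convex_comb_ge0 (x y t : R) : 0 <= x -> 0 <= y -> 0 <= t <= 1 -> 0 <= x + t * (y - x).
Proof. by move=> x0 y0 /andP[t0 t1]; nra. Qed.

Lemma convex_comb_norm_le (x y t : R) : 0 <= t <= 1 ->
  `|x + t * (y - x)| <= `|x| + t * (`|y| - `|x|).
Proof.
move=> /andP[t0 t1]; have -> : x + t * (y - x) = (1 - t) * x + t * y by ring.
have -> : `|x| + t * (`|y| - `|x|) = (1 - t) * `|x| + t * `|y| by ring.
by rewrite (le_trans (ler_normD _ _)) // !normrM (ger0_norm t0) ger0_norm ?subr_ge0.
Qed.

Section Sets.
Variables nS nA nI : nat.

Lemma SimplexP (l : 'M[R]_(nS, nA)) :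
  Simplex l <-> (forall s a, 0 <= l s a) /\ inner l (const_mx 1) = 1.
Proof. by rewrite inner_const1. Qed.

Lemma convex_Simplex : convex_mx (@Simplex R nS nA).
Proof.
move=> x y t /SimplexP[x0 x1] /SimplexP[y0 y1] t01; apply/SimplexP; split.
  by move=> s a; rewrite !mxE; exact: convex_comb_ge0.
by rewrite !innerE x1 y1; ring.
Qed.

Lemma Simplex_coord_le1 (l : 'M[R]_(nS, nA)) s a : Simplex l -> l s a <= 1.
Proof.
move=> [l0 <-]; rewrite (bigD1 s) //= (bigD1 a) //= -addrA lerDl addr_ge0 //.
  exact: sumr_ge0.
by apply: sumr_ge0 => i _; exact: sumr_ge0.
Qed.

Lemma compact_Simplex : compact (@Simplex R nS nA).
Proof.
apply: (@closed_bounded_coord_compact _ _ _ _ 1); last first.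
  by move=> l Sl s a; rewrite ger0_norm ?Simplex_coord_le1 //; case: Sl.
have cs : continuous (fun l : 'M[R]_(nS, nA) => \sum_i \sum_j l i j).
  by move=> l; apply: (@cvg_sumr _ _ _ _ (nbhs l)) => i; apply: (@cvg_sumr _ _ _ _ (nbhs l)) => j; exact: coord_continuous.
(* The equation is split into two inequalities, and the index type [unit] casts a single inequality
   into the form of [closed_forall_le]. *)
have -> : @Simplex R nS nA = [set l | forall sa : 'I_nS * 'I_nA, - l sa.1 sa.2 <= 0] `&`
   ([set l | forall _ : unit, \sum_i \sum_j l i j <= 1] `&`
    [set l | forall _ : unit, - (\sum_i \sum_j l i j) <= - 1]).
  apply/seteqP; split => [l [l0 l1]|l [l0 [l1 l1']]].
    by split => [[s a]|]; rewrite /= ?oppr_le0 // l1; split.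
  split=> [s a|]; first by have := l0 (s, a); rewrite oppr_le0.
  by apply/eqP; rewrite eq_le (l1 tt) /=; have := l1' tt; rewrite lerN2.
apply: closedI; [|apply: closedI]; apply: closed_forall_le => // i l.
- by apply: (@cvgN _ _ _ (nbhs l)); exact: coord_continuous.
- by apply: (@cvgN _ _ _ (nbhs l)); exact: cs.
Qed.

Lemma convex_Uset psi : convex_mx (@Uset R nI psi).
Proof.
move=> x y t [x0 xs] [y0 ys] t01; split.
  by move=> i; rewrite !mxE; exact: convex_comb_ge0.
apply: (@le_trans _ _ (\sum_i (`|x 0 i| + t * (`|y 0 i| - `|x 0 i|)))).
  by apply: ler_sum => i _; rewrite !mxE; exact: convex_comb_norm_le.
rewrite big_split /= -mulr_sumr sumrB; case/andP: t01 => t0 t1; nra.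
Qed.

Lemma compact_Uset psi : compact (@Uset R nI psi).
Proof.
apply: (@closed_bounded_coord_compact _ _ _ _ (2 / psi)); last first.
  move=> x [_ xs] i j; rewrite ord1; apply: le_trans xs.
  by rewrite (bigD1 j) //= lerDl sumr_ge0.
have -> : @Uset R nI psi = [set x | forall i : 'I_nI, - x 0 i <= 0] `&`
   [set x | forall _ : unit, \sum_i `|x 0 i| <= 2 / psi].
  apply/seteqP; split => [x [x0 xs]|x [x0 xs]]; split => //.
  - by move=> i; rewrite oppr_le0.
  - by move=> i; have := x0 i; rewrite oppr_le0.
  - exact: xs tt.
apply: closedI; apply: closed_forall_le => // i x.
  by apply: (@cvgN _ _ _ (nbhs x)); exact: coord_continuous.
apply: (@cvg_sumr _ _ _ _ (nbhs x)) => j; apply: (@cvg_norm _ _ _ (nbhs x)).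
exact: coord_continuous.
Qed.

Lemma convex_Vset gamma psi : convex_mx (@Vset R nS gamma psi).
Proof.
move=> x y t xs ys t01 s; rewrite !mxE (le_trans (convex_comb_norm_le _ _ t01)) //.
have := xs s; have := ys s; case/andP: t01 => t0 t1; nra.
Qed.

Lemma compact_Vset gamma psi : compact (@Vset R nS gamma psi).
Proof.
apply: (@closed_bounded_coord_compact _ _ _ _ (1 / (1 - gamma) + 2 / ((1 - gamma) * psi))).
  apply: closed_forall_le => s x; apply: (@cvg_norm _ _ _ (nbhs x)).
  exact: coord_continuous.
by move=> x xs i j; rewrite ord1; exact: xs.
Qed.

End Sets.
End FeasibleSets.

(** * The saddle operator of the Lagrangian *)

Section SaddleOperator.
Variables (R : realType) (nS nA nI : nat) (P : 'I_nA -> 'M[R]_nS) (gamma : R) (q : 'rV[R]_nS)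
  (r : 'M[R]_(nS, nA)) (g : 'I_nI -> 'M[R]_(nS, nA)) (h : 'rV[R]_nI).
Implicit Types (l : 'M[R]_(nS, nA)) (mu : 'rV[R]_nI) (v : 'rV[R]_nS).

(** The partial gradient of the Lagrangian in the maximized variable; [grad_mu] and [grad_v] are the
    opposites of the partial gradients in the minimized ones. These signs are what makes the
    operator skew. *)
Definition grad_lam mu v : 'M[R]_(nS, nA) :=
  \matrix_(s, a) (r s a - bellman gamma P v s a + \sum_(i < nI) mu 0 i * g i s a).
Definition grad_mu l : 'rV[R]_nI := \row_i (h 0 i - inner l (g i)).
Definition grad_v l : 'rV[R]_nS := flow gamma P l - (1 - gamma) *: q.

Lemma inner_rV n (x y : 'rV[R]_n) : inner x y = \sum_i x 0 i * y 0 i.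
Proof. by rewrite /inner big_ord1. Qed.

(** Adjointness of [flow] and [bellman], by exchanging sums. It expresses the coupling of [l] and
    [v] through [flow], the form in which it cancels against [grad_v]. *)
Lemma flow_bellman l v : \sum_(s < nS) \sum_(a < nA) l s a * bellman gamma P v s a =
  inner (flow gamma P l) v.
Proof.
rewrite inner_rV; under [RHS]eq_bigr do rewrite mxE mulrBl.
rewrite sumrB; under eq_bigr => s _.
  under eq_bigr do rewrite /bellman mulrBr.
  rewrite sumrB; over.
rewrite sumrB; congr (_ - _).
  by apply: eq_bigr => s _; rewrite mulr_suml.
under eq_bigr => s _ do under eq_bigr => a _ do rewrite mulrCA.
under [RHS]eq_bigr => s _ do rewrite -mulrA.
under eq_bigr => s _ do rewrite -mulr_sumr.
rewrite -!mulr_sumr; congr (_ * _).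
under eq_bigr => s _ do under eq_bigr => a _ do rewrite mulr_sumr.
under [RHS]eq_bigr => s _ do rewrite mulr_suml.
rewrite exchange_big [RHS]exchange_big /=; apply: eq_bigr => a _.
under [RHS]eq_bigr => s _ do rewrite mulr_suml.
rewrite exchange_big; apply: eq_bigr => s _; apply: eq_bigr => s' _; ring.
Qed.

Lemma inner_grad_lam l mu v : inner l (grad_lam mu v) =
  inner l r - inner (flow gamma P l) v + \sum_(i < nI) mu 0 i * inner l (g i).
Proof.
rewrite -flow_bellman /inner.
under [X in _ = _ + X]eq_bigr => i _ do rewrite mulr_sumr.
rewrite [X in _ = _ + X]exchange_big /= -sumrB -big_split /=; apply: eq_bigr => s _.
under [X in _ = _ + X]eq_bigr => i _ do rewrite mulr_sumr.
rewrite [X in _ = _ + X]exchange_big /= -sumrB -big_split /=; apply: eq_bigr => a _.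
by rewrite mxE mulrDr mulrBr mulr_sumr; congr (_ + _); apply: eq_bigr => i _; ring.
Qed.

Lemma LagrangianE l mu v : Lagrangian gamma P q r g h l mu v =
  inner l (grad_lam mu v) - inner mu h + (1 - gamma) * inner q v.
Proof.
rewrite /Lagrangian flow_bellman inner_grad_lam !inner_rV.
under eq_bigr do rewrite mulrBr; rewrite sumrB; ring.
Qed.

Lemma flowB l l' : flow gamma P (l - l') = flow gamma P l - flow gamma P l'.
Proof.
apply/rowP => s; rewrite !mxE.
under eq_bigr do rewrite !mxE; rewrite sumrB.
under [X in _ - gamma * X]eq_bigr => a _.
  under eq_bigr do rewrite !mxE mulrBr.
  rewrite sumrB; over.
by rewrite sumrB; ring.
Qed.

Definition saddle_op (z : 'rV[R]_(nS * nA + (nI + nS))) : 'rV[R]_(nS * nA + (nI + nS)) :=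
  let l := vec_mx (lsubmx z) in let mu := lsubmx (rsubmx z) in let v := rsubmx (rsubmx z) in
  row_mx (mxvec (grad_lam mu v)) (row_mx (grad_mu l) (grad_v l)).

Lemma saddle_op_row l mu v : saddle_op (row_mx (mxvec l) (row_mx mu v)) =
  row_mx (mxvec (grad_lam mu v)) (row_mx (grad_mu l) (grad_v l)).
Proof. by rewrite /saddle_op !(row_mxKl, row_mxKr) mxvecK. Qed.

Lemma row_mx_vecK (z : 'rV[R]_(nS * nA + (nI + nS))) :
  z = row_mx (mxvec (vec_mx (lsubmx z) : 'M[R]_(nS, nA))) (row_mx (lsubmx (rsubmx z)) (rsubmx (rsubmx z))).
Proof. by rewrite vec_mxK !hsubmxK. Qed.

(* The coupling terms of a convex-concave bilinear saddle problem cancel. *)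
Lemma saddle_op_skew z w : inner (z - w) (saddle_op z) = inner (z - w) (saddle_op w).
Proof.
rewrite (row_mx_vecK z) (row_mx_vecK w) !saddle_op_row.
move: (vec_mx (lsubmx z)) (lsubmx (rsubmx z)) (rsubmx (rsubmx z)) => l mu v.
move: (vec_mx (lsubmx w)) (lsubmx (rsubmx w)) (rsubmx (rsubmx w)) => l' mu' v'.
apply/eqP; rewrite -subr_eq0 -innerNr -innerDr !(opp_row_mx, add_row_mx) -!linearB /=.
rewrite !inner_row_mx inner_mxvec.
have -> : inner (l - l') (grad_lam mu v - grad_lam mu' v') =
    - inner (flow gamma P (l - l')) (v - v') + \sum_i (mu 0 i - mu' 0 i) * inner (l - l') (g i).
  rewrite innerDr innerNr !inner_grad_lam innerDr innerNr.
  under [X in _ = _ + X]eq_bigr do rewrite mulrBl.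
  by rewrite sumrB; ring.
have -> : grad_v l - grad_v l' = flow gamma P (l - l').
  by rewrite flowB /grad_v opprB addrA subrK.
rewrite (innerC (v - v')) [X in _ + (X + _)](_ : _ =
  - \sum_i (mu 0 i - mu' 0 i) * inner (l - l') (g i)); first by apply/eqP; ring.
by rewrite inner_rV -sumrN; apply: eq_bigr => i _; rewrite !mxE innerDl innerNl; ring.
Qed.

Lemma saddle_op_continuous : continuous saddle_op.
Proof.
move=> z; have lz : lsubmx y @[y --> z] --> lsubmx z.
  by apply: (@cvg_lsubmx _ _ (nbhs z)); exact: cvg_id.
have rz : rsubmx y @[y --> z] --> rsubmx z.
  by apply: (@cvg_rsubmx _ _ (nbhs z)); exact: cvg_id.
have lamz := @cvg_vec_mx _ _ (nbhs z) (nbhs_filter z) nS nA _ _ lz.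
have muz := @cvg_lsubmx _ _ (nbhs z) (nbhs_filter z) _ _ _ _ _ rz.
have vz := @cvg_rsubmx _ _ (nbhs z) (nbhs_filter z) _ _ _ _ _ rz.
apply: (@cvg_row_mx _ _ (nbhs z)).
  apply: (@cvg_mxvec _ _ (nbhs z)); apply: (@cvg_mx_coord _ _ _ _ (nbhs z)) => s a.
  rewrite mxE; under eq_fun do rewrite mxE.
  apply: (@cvgD _ _ _ (nbhs z)).
    apply: (@cvgB _ _ _ (nbhs z)); first exact: cvg_cst.
    apply: (@cvgB _ _ _ (nbhs z)); first exact: (@cvg_coord _ _ _ _ _ _ _ _ _ _ vz).
    apply: (@cvgMr _ _ (nbhs z)); apply: (@cvg_sumr _ _ _ _ (nbhs z)) => s'.
    by apply: (@cvgMr _ _ (nbhs z)); exact: (@cvg_coord _ _ _ _ _ _ _ _ _ _ vz).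
  apply: (@cvg_sumr _ _ _ _ (nbhs z)) => i.
  by apply: (@cvgMl _ _ (nbhs z)); exact: (@cvg_coord _ _ _ _ _ _ _ _ _ _ muz).
apply: (@cvg_row_mx _ _ (nbhs z)); apply: (@cvg_mx_coord _ _ _ _ (nbhs z)) => i j.
  rewrite mxE; under eq_fun do rewrite mxE.
  apply: (@cvgB _ _ _ (nbhs z)); first exact: cvg_cst.
  by apply: (@cvg_inner _ _ _ _ (nbhs z)) => //; exact: cvg_cst.
rewrite !mxE; under eq_fun do rewrite !mxE.
apply: (@cvgB _ _ _ (nbhs z)); last exact: cvg_cst.
apply: (@cvgB _ _ _ (nbhs z)).
  by apply: (@cvg_sumr _ _ _ _ (nbhs z)) => a; exact: (@cvg_coord _ _ _ _ _ _ _ _ _ _ lamz).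
apply: (@cvgMr _ _ (nbhs z)); apply: (@cvg_sumr _ _ _ _ (nbhs z)) => a.
apply: (@cvg_sumr _ _ _ _ (nbhs z)) => s'.
by apply: (@cvgMr _ _ (nbhs z)); exact: (@cvg_coord _ _ _ _ _ _ _ _ _ _ lamz).
Qed.

End SaddleOperator.

(** * From a saddle point over the bounded sets to one of the full Lagrangian *)

Section RestrictedSaddle.
Variables (R : realType) (nS nA nI : nat) (P : 'I_nA -> 'M[R]_nS) (gamma : R) (q : 'rV[R]_nS)
  (r : 'M[R]_(nS, nA)) (g : 'I_nI -> 'M[R]_(nS, nA)) (h : 'rV[R]_nI).
Variables (psi : R) (lamt : 'M[R]_(nS, nA)).
Hypothesis P0 : forall a s s', 0 <= P a s s'.
Hypothesis P1 : forall a s, \sum_(s' < nS) P a s s' = 1.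
Hypothesis gamma01 : 0 < gamma < 1.
Hypothesis q0 : forall s, 0 <= q 0 s.
Hypothesis q1 : \sum_(s < nS) q 0 s = 1.
Hypothesis r01 : forall s a, 0 <= r s a <= 1.
Hypothesis g11 : forall i s a, -1 <= g i s a <= 1.
Hypothesis psi0 : 0 < psi.
Hypothesis Slamt : Simplex lamt.
Hypothesis slater : forall i, inner lamt (g i) >= h 0 i + psi.
Hypothesis flowt : flow gamma P lamt = (1 - gamma) *: q.

Variables (l : 'M[R]_(nS, nA)) (mu : 'rV[R]_nI) (v : 'rV[R]_nS).
Hypothesis Sl : Simplex l.
Hypothesis Umu : @Uset R nI psi mu.
Hypothesis Vv : @Vset R nS gamma psi v.
Hypothesis l_opt : forall l', Simplex l' -> 0 <= inner (l - l') (grad_lam P gamma r g mu v).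
Hypothesis mu_opt : forall mu', @Uset R nI psi mu' -> 0 <= inner (mu - mu') (grad_mu g h l).
Hypothesis v_opt : forall v', @Vset R nS gamma psi v' -> 0 <= inner (v - v') (grad_v P gamma q l).

Let M := \sum_(i < nI) mu 0 i.
Let B := 1 / (1 - gamma) + 2 / ((1 - gamma) * psi).
Let gm1 : 0 < 1 - gamma. Proof. by case/andP: gamma01 => *; lra. Qed.
Let mu0 i : 0 <= mu 0 i. Proof. by case: Umu. Qed.

Let BE : (1 - gamma) * B = 1 + 2 / psi.
Proof. by rewrite /B; field; rewrite !gt_eqF. Qed.

Let B0 : 0 <= B.
Proof. by rewrite addr_ge0 // divr_ge0 // ?mulr_ge0 // ltW. Qed.

Let M_le : M <= 2 / psi.
Proof.
case: Umu => _; apply: le_trans; apply: ler_sum => i _; exact: ler_norm.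
Qed.

Let mean_bound (p x : 'I_nS -> R) b : (forall s, 0 <= p s) -> \sum_s p s = 1 ->
  (forall s, `|x s| <= b) -> `|\sum_s p s * x s| <= b.
Proof.
move=> p0 p1 xb; rewrite -[leRHS]mul1r -p1 mulr_suml (le_trans (ler_norm_sum _ _ _)) //.
by apply: ler_sum => s _; rewrite normrM (ger0_norm (p0 s)) ler_wpM2l.
Qed.

Let cost_bound s a : `|\sum_(i < nI) mu 0 i * g i s a| <= M.
Proof.
rewrite (le_trans (ler_norm_sum _ _ _)) //; apply: ler_sum => i _.
by rewrite normrM (ger0_norm (mu0 i)) ler_piMr // ler_norml.
Qed.

(** Both [l] and [q] have total mass 1 and the rows of [P] sum to 1, so the total is
    [1 - gamma - (1 - gamma)]. Hence a nonzero violation takes both signs. *)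
Let grad_v_sum : \sum_s grad_v P gamma q l 0 s = 0.
Proof.
under eq_bigr do rewrite !mxE; rewrite !sumrB -!mulr_sumr q1.
case: (Sl) => _ ->; rewrite exchange_big /=.
under eq_bigr do rewrite exchange_big /=.
under eq_bigr => a _ do under eq_bigr => s _ do rewrite -mulr_suml P1 mul1r.
rewrite exchange_big /=; case: (Sl) => _ ->; ring.
Qed.

(* A violated flow constraint pushes [v] to opposite faces of the box at a state [s1] with
   too much mass and a state [s2] with too little; by the size of the box, moving mass
   from [s1] to [s2] would then improve [l]. *)
Lemma restricted_saddle_flow : flow gamma P l = (1 - gamma) *: q.
Proof.
apply/eqP; rewrite -subr_eq0; apply/negPn/negP => e0.
set e := flow gamma P l - _ in e0; have eE : e = grad_v P gamma q l by [].
have [s es] : exists s, e 0 s != 0.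
  apply/existsP; move: e0; apply: contraR => /existsPn es.
  by apply/eqP/rowP => s; have := es s; rewrite negbK => /eqP ->; rewrite mxE.
have [s1 es1] : exists s1, 0 < e 0 s1.
  apply/existsP; apply: contraT => /existsPn h'.
  have : \sum_s - e 0 s == 0 by rewrite sumrN eE grad_v_sum oppr0.
  rewrite psumr_eq0 => [/allP /(_ s (mem_index_enum _))|s' _].
    by rewrite oppr_eq0 (negPf es).
  by rewrite oppr_ge0 leNgt.
have [s2 es2] : exists s2, e 0 s2 < 0.
  apply/existsP; apply: contraT => /existsPn h'.
  have : \sum_s e 0 s == 0 by rewrite eE grad_v_sum.
  rewrite psumr_eq0 => [/allP /(_ s (mem_index_enum _))|s' _].
    by rewrite (negPf es).
  by rewrite leNgt.
have move_v s' c : `|c| <= B -> 0 <= (v 0 s' - c) * e 0 s'.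
  move=> cB; have := v_opt (v' := v + (c - v 0 s') *: delta_mx 0 s') _.
  rewrite opprD addrA subrr sub0r innerNl innerZl inner_delta -eE => h'.
  rewrite -opprB mulNr; apply: h' => k; rewrite !mxE eqxx /=.
  have [->|_] := eqVneq k s'; first by rewrite mulr1 subrKC.
  by rewrite mulr0 addr0; exact: Vv.
have v1 : B <= v 0 s1.
  by have := move_v s1 B; rewrite ger0_norm // pmulr_lge0 // subr_ge0; exact.
have v2 : v 0 s2 <= - B.
  have := move_v s2 (- B); rewrite normrN ger0_norm // nmulr_lge0 // subr_le0; exact.
(* The remaining terms of [e 0 s1], the inflow and the initial mass, enter with a negative sign, so
   a positive excess requires mass at [s1]. *)
have [a la] : exists a, 0 < l s1 a.
  apply/existsP; apply: contraT => /existsPn h'.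
  have ls0 : \sum_a l s1 a <= 0 by apply: sumr_le0 => a _; rewrite leNgt.
  suff : e 0 s1 <= 0 by rewrite leNgt es1.
  rewrite /e !mxE.
  have : 0 <= gamma * \sum_(a < nA) \sum_(s' < nS) P a s' s1 * l s' a.
    case/andP: gamma01 => g0 _; apply: mulr_ge0; first exact: ltW.
    apply: sumr_ge0 => a _; apply: sumr_ge0 => s' _; apply: mulr_ge0 => //.
    by case: Sl.
  have : 0 <= (1 - gamma) * q 0 s1 by rewrite mulr_ge0 // ltW.
  lra.
have s12 : s1 != s2 by apply: contraTneq es1 => ->; rewrite -leNgt ltW.
have := l_opt (l' := l - l s1 a *: (delta_mx s1 a - delta_mx s2 a)) _.
rewrite subKr innerZl innerDl innerNl !inner_delta => h'.
have : 0 <= l s1 a * (grad_lam P gamma r g mu v s1 a - grad_lam P gamma r g mu v s2 a).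
  apply: h'; apply/SimplexP; case/SimplexP: (Sl) => l0 l1; split; last first.
    by rewrite innerDl innerNl innerZl innerDl innerNl !inner_delta !mxE l1 subrr mulr0 subr0.
  move=> s' a'; rewrite !mxE.
  have [/= ->|n1] := eqVneq s' s1; have [/= ->|na] := eqVneq a' a;
    rewrite ?(negPf s12) /= ?andbF ?andbT /= ?subr0 ?mulr1 ?mulr0 ?subrr ?subr0 //.
  rewrite sub0r mulrN opprK addr_ge0 // mulr_ge0 //; exact: ler0n.
rewrite pmulr_rge0 // !mxE /bellman.
(* The gradient is at most [1 - (1 - gamma) * B + M] at [(s1, a)] and at least [(1 - gamma) * B - M]
   at [(s2, a)]. By [BE] and [M_le] the first minus the second is at most [-1], against the
   optimality of [l]. *)
have p1 := mean_bound (P0 a s1) (P1 a s1) Vv.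
have p2 := mean_bound (P0 a s2) (P1 a s2) Vv.
have := cost_bound s1 a; have := cost_bound s2 a.
have := r01 s1 a; have := r01 s2 a.
move: p1 p2; rewrite -/B !ler_norml.
move: (\sum_(s' < nS) _) (\sum_(s' < nS) _) (\sum_(i < nI) _) (\sum_(i < nI) _) => x1 x2 y1 y2.
move=> /andP[x1l x1u] /andP[x2l x2u] /andP[r1l r1u] /andP[r2l r2u] /andP[y1l y1u] /andP[y2l y2u].
have [gam0 _] := andP gamma01.
have : gamma * x1 <= gamma * B by rewrite ler_pM2l.
have : gamma * (- B) <= gamma * x2 by rewrite ler_pM2l.
move: BE M_le psi0; set w := 2 / psi => BE' M_le' _; have w0 : 0 < w by rewrite divr_gt0.
nra.
Qed.

(** Once the flow constraint holds, the Lagrangian at [l] no longer depends on [v], so the box is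
    harmless. Slater's condition keeps [mu] away from the upper face of [Uset], so a short step
    towards any nonnegative [mu'] is admissible, and linearity extends the inequality to the full
    step. *)
Lemma restricted_saddle_full : saddle_point (Lagrangian gamma P q r g h) l mu v.
Proof.
have fl := restricted_saddle_flow.
have dual : \sum_(i < nI) mu 0 i * (h 0 i + psi) + inner (flow gamma P lamt) v
    <= inner lamt r + \sum_(i < nI) mu 0 i * inner lamt (g i) + inner (flow gamma P lamt) v.
  rewrite lerD2r; apply: ler_wpDl; last by apply: ler_sum => i _; rewrite ler_wpM2l.
  apply: sumr_ge0 => s _; apply: sumr_ge0 => a _; apply: mulr_ge0.
    by case: Slamt.
  by case/andP: (r01 s a).
(* Comparing [l] with [lamt] bounds [psi * M] by [inner l r] plus the sum of
   [mu 0 i * (inner l (g i) - h 0 i)]; comparing [mu] with 0 makes that sum nonpositive, and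
   [inner l r <= 1]. *)
have psiM : psi * M <= 1.
  have lr : inner l r <= 1.
    case: (Sl) => l0 <-; apply: ler_sum => s _; apply: ler_sum => a _.
    by rewrite ler_piMr //; case/andP: (r01 s a).
  have := l_opt Slamt; rewrite innerDl innerNl !inner_grad_lam fl -flowt.
  have U0 : @Uset R nI psi 0.
    split=> [i|]; first by rewrite mxE.
    by rewrite big1 ?divr_ge0 ?(ltW psi0) // => i _; rewrite mxE normr0.
  have := mu_opt U0; rewrite subr0 inner_rV.
  under eq_bigr do rewrite mxE mulrBr; rewrite sumrB.
  move: dual; under eq_bigr do rewrite mulrDr; rewrite big_split /= -mulr_suml -/M (mulrC M).
  lra.
have grad_v0 : grad_v P gamma q l = 0 by rewrite /grad_v fl subrr.
split=> //; split=> //; split.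
  move=> l' Sl'; rewrite !LagrangianE; have := l_opt Sl'; rewrite innerDl innerNl; lra.
move=> mu' v' mu'0.
have LE m w : Lagrangian gamma P q r g h l m w = inner l r - inner m (grad_mu g h l).
  rewrite LagrangianE inner_grad_lam fl innerZl; rewrite (_ : inner m (grad_mu g h l) =
    inner m h - \sum_(i < nI) m 0 i * inner l (g i)); first by ring.
  by rewrite !inner_rV -sumrB; apply: eq_bigr => i _; rewrite mxE mulrBr.
rewrite !LE lerD2l lerN2 -subr_ge0 -innerNl -innerDl.
pose M' := \sum_(i < nI) mu' 0 i; have M'0 : 0 <= M' by exact: sumr_ge0.
have d0 : 0 < 1 + psi * M' by rewrite ltr_wpDr // mulr_ge0 // ltW.
(* The mass of the mixture, times [psi], is [(1 - t) * (psi * M) + t * (psi * M')]; each summand is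
   at most 1, which is exactly the budget [2 / psi] of [Uset]. *)
pose t := (1 + psi * M')^-1.
have t0 : 0 < t by rewrite invr_gt0.
have t1 : t <= 1 by rewrite invf_le1 // lerDl mulr_ge0 // ltW.
have tM' : t * (psi * M') <= 1.
  by rewrite -[leRHS](mulVf (x := 1 + psi * M')) ?gt_eqF // ler_pM2l //; lra.
have Umix : @Uset R nI psi (mu + t *: (mu' - mu)).
  have t01 : 0 <= t <= 1 by rewrite t1 ltW.
  have mix0 i : 0 <= (mu + t *: (mu' - mu)) 0 i by rewrite !mxE; exact: convex_comb_ge0.
  split=> //; under eq_bigr => i _ do rewrite ger0_norm //.
  under eq_bigr do rewrite !mxE; rewrite big_split /= -mulr_sumr sumrB -/M -/M'.
  rewrite ler_pdivlMr //; have : 0 <= psi * (t * M) by rewrite !mulr_ge0 ?sumr_ge0 // ltW.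
  by move: psiM tM'; nra.
have := mu_opt Umix.
rewrite opprD addrA subrr sub0r innerNl innerZl -mulrN -innerNl opprB.
by rewrite pmulr_rge0.
Qed.

End RestrictedSaddle.

(** * The six equations assembled into one flow *)

Theorem theorem2 (R : realType) (nS nA nI : nat)
  (P : 'I_nA -> 'M[R]_nS) (gamma : R) (q : 'rV[R]_nS)
  (r : 'M[R]_(nS, nA)) (g : 'I_nI -> 'M[R]_(nS, nA)) (h : 'rV[R]_nI)
  (psi rho : R) (lamt : 'M[R]_(nS, nA))
  (lam lamh : R -> 'M[R]_(nS, nA)) (mu muh : R -> 'rV[R]_nI)
  (v vh : R -> 'rV[R]_nS) :
  (* MDP data *)
  (forall a s s', 0 <= P a s s') ->
  (forall a s, \sum_(s' < nS) P a s s' = 1) ->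
  0 < gamma < 1 ->
  (forall s, 0 <= q 0 s) -> \sum_(s < nS) q 0 s = 1 ->
  (forall s a, 0 <= r s a <= 1) ->
  (forall i s a, -1 <= g i s a <= 1) ->
  (* Slater's condition *)
  0 < psi ->
  Simplex lamt ->
  (forall i, inner lamt (g i) >= h 0 i + psi) ->
  flow gamma P lamt = (1 - gamma) *: q ->
  0 < rho ->
  (* initialization *)
  Simplex (lam 0) -> Simplex (lamh 0) ->
  @Uset R nI psi (mu 0) -> @Uset R nI psi (muh 0) ->
  @Vset R nS gamma psi (v 0) -> @Vset R nS gamma psi (vh 0) ->
  (* projected saddle flow dynamics *)
  proj_solution (@Vset R nS gamma psi) v
    (fun t => flow gamma P (lam t) - (1 - gamma) *: q - rho^-1 *: (v t - vh t)) ->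
  proj_solution (@Vset R nS gamma psi) vh (fun t => rho^-1 *: (v t - vh t)) ->
  proj_solution (@Uset R nI psi) mu
    (fun t => \row_i (h 0 i - inner (lam t) (g i)) - rho^-1 *: (mu t - muh t)) ->
  proj_solution (@Uset R nI psi) muh (fun t => rho^-1 *: (mu t - muh t)) ->
  proj_solution (@Simplex R nS nA) lam
    (fun t => \matrix_(s, a) (r s a - bellman gamma P (v t) s a
                              + \sum_(i < nI) mu t 0 i * g i s a)
              - rho^-1 *: (lam t - lamh t)) ->
  proj_solution (@Simplex R nS nA) lamh (fun t => rho^-1 *: (lam t - lamh t)) ->
  (exists (lams : 'M[R]_(nS, nA)) (mus : 'rV[R]_nI) (vs : 'rV[R]_nS),
      saddle_point (Lagrangian gamma P q r g h) lams mus vs /\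
      lam t @[t --> +oo] --> lams /\ lamh t @[t --> +oo] --> lams /\
      mu t @[t --> +oo] --> mus /\ muh t @[t --> +oo] --> mus /\
      v t @[t --> +oo] --> vs /\ vh t @[t --> +oo] --> vs) /\
  (forall t, 0 <= t -> Simplex (lam t) /\ @Uset R nI psi (mu t)).
Proof.
move=> P0 P1 gamma01 q0 q1 r01 g11 psi0 Slamt slater flowt rho0.
move=> Sl0 Slh0 Um0 Umh0 Vv0 Vvh0 solv solvh solm solmh soll sollh.
pose U := @Uset R nI psi; pose W := @Vset R nS gamma psi; pose S := @Simplex R nS nA.
have cU : compact U by exact: compact_Uset.
have cW : compact W by exact: compact_Vset.
have cS : compact S by exact: compact_Simplex.
have vU : convex_mx U by exact: convex_Uset.
have vW : convex_mx W by exact: convex_Vset.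
have vS : convex_mx S by exact: convex_Simplex.
have {}solv := proj_solution_vi cW vW Vv0 solv.
have {}solvh := proj_solution_vi cW vW Vvh0 solvh.
have {}solm := proj_solution_vi cU vU Um0 solm.
have {}solmh := proj_solution_vi cU vU Umh0 solmh.
have {}soll := proj_solution_vi cS vS Sl0 soll.
have {}sollh := proj_solution_vi cS vS Slh0 sollh.
split; last by move=> t t0; split; [case: soll => + _ _|case: solm => + _ _]; exact.
pose K := prod_mx (vec_set S) (prod_mx U W).
pose F := saddle_op P gamma q r g h.
pose z t := row_mx (mxvec (lam t)) (row_mx (mu t) (v t)).
pose zh t := row_mx (mxvec (lamh t)) (row_mx (muh t) (vh t)).
have cK : compact K by apply: compact_prod_mx; [exact: compact_vec_set|exact: compact_prod_mx].
have vK : convex_mx K by apply: convex_prod_mx; [exact: convex_vec_set|exact: convex_prod_mx].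
have K0 : K !=set0.
  by exists (z 0); apply: prod_mx_row; [exact: vec_set_mxvec|exact: prod_mx_row].
have gapE t : rho^-1 *: (z t - zh t) = row_mx (mxvec (rho^-1 *: (lam t - lamh t)))
    (row_mx (rho^-1 *: (mu t - muh t)) (rho^-1 *: (v t - vh t))).
  by rewrite /z /zh !(opp_row_mx, add_row_mx, scale_row_mx) -linearB -linearZ.
have zsol : vi_solution K z (fun t => F (z t) - rho^-1 *: (z t - zh t)).
  rewrite (_ : (fun t => _) = fun t => row_mx
     (mxvec (grad_lam P gamma r g (mu t) (v t) - rho^-1 *: (lam t - lamh t)))
     (row_mx (grad_mu g h (lam t) - rho^-1 *: (mu t - muh t))
       (grad_v P gamma q (lam t) - rho^-1 *: (v t - vh t)))).
    apply: vi_solution_row_mx; first exact: vi_solution_mxvec.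
    exact: vi_solution_row_mx.
  by apply/funext => t; rewrite gapE /F saddle_op_row !(opp_row_mx, add_row_mx) -linearB.
have zhsol : vi_solution K zh (fun t => rho^-1 *: (z t - zh t)).
  rewrite (_ : (fun t => _) = fun t => row_mx (mxvec (rho^-1 *: (lam t - lamh t)))
    (row_mx (rho^-1 *: (mu t - muh t)) (rho^-1 *: (v t - vh t)))).
    apply: vi_solution_row_mx; first exact: vi_solution_mxvec.
    exact: vi_solution_row_mx.
  by apply/funext => t; rewrite gapE.
have [G FG] := continuous_inner_bounded cK K0 (@saddle_op_continuous _ _ _ _ P gamma q r g h).
have skewF x y : K x -> K y -> inner (x - y) (F x) = inner (x - y) (F y).
  by move=> _ _; exact: saddle_op_skew.
have [zb [Kzb zbM zcvg zhcvg]] := proximal_flow_cvg cK vK FG skewF rho0 zsol zhsol.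
(* Skewness moves the field from the test point [w] to the solution [zb], where its blocks are the
   partial gradients at [(l, m, w)]. *)
have zbvi w : K w -> 0 <= inner (zb - w) (F zb) by move=> Kw; rewrite skewF //; exact: zbM.
pose l := vec_mx (lsubmx zb) : 'M[R]_(nS, nA); pose m := lsubmx (rsubmx zb); pose w := rsubmx (rsubmx zb).
have zbE : zb = row_mx (mxvec l) (row_mx m w) by exact: row_mx_vecK.
have [Sl [Um Vw]] : S l /\ U m /\ W w by case: Kzb => ? [? ?].
(* Freezing two of the three blocks of the test point turns this single inequality into separate
   optimality conditions for [l], [m] and [w]. *)
have block l' m' w' : S l' -> U m' -> W w' ->
    0 <= inner (l - l') (grad_lam P gamma r g m w) + (inner (m - m') (grad_mu g h l)
      + inner (w - w') (grad_v P gamma q l)).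
  move=> Sl' Um' Vw'; have := zbvi (row_mx (mxvec l') (row_mx m' w')).
  rewrite {1 2}zbE /F saddle_op_row !(opp_row_mx, add_row_mx) -linearB !inner_row_mx inner_mxvec.
  by apply; apply: prod_mx_row; [exact: vec_set_mxvec|exact: prod_mx_row].
exists l, m, w; split.
  apply: (restricted_saddle_full (psi := psi) (lamt := lamt)) => //.
  - by move=> l' Sl'; have := block l' m w Sl' Um Vw; rewrite !subrr !inner0l !addr0.
  - by move=> m' Um'; have := block l m' w Sl Um' Vw; rewrite !subrr !inner0l add0r addr0.
  - by move=> w' Vw'; have := block l m w' Sl Um Vw'; rewrite !subrr !inner0l !add0r.
have lE (x : R -> 'M[R]_(nS, nA)) (y : R -> 'rV[R]_nI) (u : R -> 'rV[R]_nS) :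
    row_mx (mxvec (x t)) (row_mx (y t) (u t)) @[t --> +oo] --> zb ->
    [/\ x t @[t --> +oo] --> l, y t @[t --> +oo] --> m & u t @[t --> +oo] --> w].
  pose f t := row_mx (mxvec (x t)) (row_mx (y t) (u t)); move=> xyu.
  have xE : x = fun t => vec_mx (lsubmx (f t)) by apply/funext => t; rewrite row_mxKl mxvecK.
  have yE : y = fun t => lsubmx (rsubmx (f t)) by apply/funext => t; rewrite row_mxKr row_mxKl.
  have uE : u = fun t => rsubmx (rsubmx (f t)) by apply/funext => t; rewrite !row_mxKr.
  rewrite xE yE uE; split.
  - by apply: cvg_vec_mx; exact: cvg_lsubmx.
  - by apply: cvg_lsubmx; exact: cvg_rsubmx.
  - by apply: cvg_rsubmx; exact: cvg_rsubmx.
have [h1 h2 h3] := lE _ _ _ zcvg; have [h4 h5 h6] := lE _ _ _ zhcvg.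
by do !split.
Qed.
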